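(* Let $p$ be a prime, $d,m\ge1$, $n=d+m$, let $\mathcal{U}\subseteq\mathbb{Z}_p^d$ be open and $\mathbf{f}:\mathcal{U}\to\mathbb{Z}_p^m$ a $C^2$ map; for $\mathbf{x}\in\mathcal{U}$ set $\mathbf{F}(\mathbf{x})=(\mathbf{x},\mathbf{f}(\mathbf{x}))\in\mathbb{Z}_p^n$. Suppose $\boldsymbol{\tau}=(\tau_1,\dots,\tau_n)\in\mathbb{R}_+^n$ with each $\tau_i>1$, $$\sum_{i=1}^n\tau_i=n+1\quad\text{and}\quad \min_{1\le i\le d}\tau_i\ \ge\ \max_{1\le j\le m}\tau_{d+j}.$$ Then $\mu_d\big(\mathbf{F}^{-1}(\mathbf{Bad}^{(p)}_n(\boldsymbol{\tau}))\big)=0$.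
   Context: $\mathbb{Z}_p$ is the ring of $p$-adic integers with absolute value $|\cdot|_p$ ($|p|_p=p^{-1}$); $C^2$ is meant in the sense of $p$-adic (ultrametric) calculus; $\mu_d$ is Haar measure on $\mathbb{Z}_p^d$ normalized to total mass 1. For $\tilde{\mathbf{b}}=(b_0,\dots,b_n)\in\mathbb{Z}^{n+1}$ let $\|\tilde{\mathbf{b}}\|_\infty=\max_i|b_i|$. For $c>0$ let $W(c;\boldsymbol{\tau})$ be the set of $\mathbf{y}\in\mathbb{Z}_p^n$ such that there are infinitely many $\tilde{\mathbf{b}}\in\mathbb{Z}^{n+1}$ with $|b_0y_i-b_i|_p<c\,\|\tilde{\mathbf{b}}\|_\infty^{-\tau_i}$ for all $1\le i\le n$. Then $\mathbf{Bad}^{(p)}_n(\boldsymbol{\tau})=W(1;\boldsymbol{\tau})\setminus\bigcap_{k\in\mathbb{N}}W(\tfrac1k;\boldsymbol{\tau})$. *)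

(* Defs.v *)
From HB Require Import structures.
From mathcomp Require Import all_boot all_order all_algebra fraction.
From mathcomp Require Import all_classical all_reals all_analysis.

Set Implicit Arguments.
Unset Strict Implicit.
Unset Printing Implicit Defensive.

Import Order.TTheory GRing.Theory Num.Theory.

Local Open Scope classical_set_scope.
Local Open Scope ring_scope.

(* Z_p is the inverse limit of the rings Z/p^k: the k-th residue is kept in
   reduced form, i.e. in {0, ..., p^k - 1}. *)
Record padicZ (p : nat) (hp : prime p) := PadicZ {
  residue :> nat -> int;
  _ : `[< forall k, residue k = (residue k.+1 %% (p ^ k)%N)%Z >] }.

HB.instance Definition _ p (hp : prime p) := [isSub for @residue p hp].
HB.instance Definition _ p (hp : prime p) := [Choice of padicZ hp by <:].

Section PadicIntegers.
Context {p : nat} {hp : prime p}.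
Local Notation Zp := (padicZ hp).
Implicit Types (x y z : Zp) (k : nat).

Lemma residueP x k : residue x k = (residue x k.+1 %% (p ^ k)%N)%Z.
Proof. by case: x => r /= /asboolP. Qed.

Lemma residue_modS (a : int) k :
  ((a %% (p ^ k.+1)%N)%Z %% (p ^ k)%N)%Z = (a %% (p ^ k)%N)%Z.
Proof.
rewrite {2}(divz_eq a (p ^ k.+1)%N) expnSr PoszM [(p ^ k)%N%:Z * _]mulrC mulrA.
by rewrite modzMDl.
Qed.

Lemma residue_mod x k : (residue x k %% (p ^ k)%N)%Z = residue x k.
Proof. by rewrite [in RHS]residueP [in LHS]residueP modz_mod. Qed.

Lemma padicZ_eq x y : (forall k, residue x k = residue y k) -> x = y.
Proof. by move=> xy; apply/val_inj/funext. Qed.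

Fact reduce_subproof (r : nat -> int) :
    (forall k, (r k.+1 %% (p ^ k)%N)%Z = (r k %% (p ^ k)%N)%Z) ->
  `[< forall k, (r k %% (p ^ k)%N)%Z =
      ((r k.+1 %% (p ^ k.+1)%N)%Z %% (p ^ k)%N)%Z >].
Proof. by move=> h; apply/asboolP => k; rewrite residue_modS h. Qed.

Definition reduce r h : Zp := PadicZ hp (@reduce_subproof r h).

Fact padicZ_const_subproof (a : int) k :
  (a %% (p ^ k)%N)%Z = (a %% (p ^ k)%N)%Z.
Proof. by []. Qed.
Definition padicZ_const (a : int) : Zp := reduce (padicZ_const_subproof a).

Fact padicZ_opp_subproof x k :
  ((- residue x k.+1) %% (p ^ k)%N)%Z = ((- residue x k) %% (p ^ k)%N)%Z.
Proof. by rewrite [in RHS]residueP modzNm. Qed.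
Definition padicZ_opp x := reduce (padicZ_opp_subproof x).

Fact padicZ_add_subproof x y k :
  ((residue x k.+1 + residue y k.+1) %% (p ^ k)%N)%Z =
  ((residue x k + residue y k) %% (p ^ k)%N)%Z.
Proof. by rewrite (residueP x k) (residueP y k) modzDm. Qed.
Definition padicZ_add x y := reduce (padicZ_add_subproof x y).

Fact padicZ_mul_subproof x y k :
  ((residue x k.+1 * residue y k.+1) %% (p ^ k)%N)%Z =
  ((residue x k * residue y k) %% (p ^ k)%N)%Z.
Proof. by rewrite (residueP x k) (residueP y k) modzMm. Qed.
Definition padicZ_mul x y := reduce (padicZ_mul_subproof x y).

Fact padicZ_addA : associative padicZ_add.
Proof.
by move=> x y z; apply: padicZ_eq => k /=; rewrite modzDml modzDmr addrA.
Qed.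
Fact padicZ_addC : commutative padicZ_add.
Proof. by move=> x y; apply: padicZ_eq => k /=; rewrite addrC. Qed.
Fact padicZ_add0 : left_id (padicZ_const 0) padicZ_add.
Proof.
by move=> x; apply: padicZ_eq => k /=; rewrite mod0z add0r residue_mod.
Qed.
Fact padicZ_addN : left_inverse (padicZ_const 0) padicZ_opp padicZ_add.
Proof. by move=> x; apply: padicZ_eq => k /=; rewrite modzDml addNr. Qed.

HB.instance Definition _ := GRing.isZmodule.Build Zp
  padicZ_addA padicZ_addC padicZ_add0 padicZ_addN.

Fact padicZ_mulA : associative padicZ_mul.
Proof.
by move=> x y z; apply: padicZ_eq => k /=; rewrite modzMml modzMmr mulrA.
Qed.
Fact padicZ_mulC : commutative padicZ_mul.
Proof. by move=> x y; apply: padicZ_eq => k /=; rewrite mulrC. Qed.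
Fact padicZ_mul1 : left_id (padicZ_const 1) padicZ_mul.
Proof.
by move=> x; apply: padicZ_eq => k /=; rewrite modzMml mul1r residue_mod.
Qed.
Fact padicZ_mulDl : left_distributive padicZ_mul +%R.
Proof.
by move=> x y z; apply: padicZ_eq => k /=; rewrite modzMml modzDm mulrDl.
Qed.
Fact padicZ_one_neq0 : padicZ_const 1 != 0.
Proof.
apply/eqP => /(congr1 (fun x : Zp => residue x 1)) /=.
rewrite expn1 mod0z modz_small// ltz_nat prime_gt1//.
Qed.

HB.instance Definition _ := GRing.Zmodule_isComNzRing.Build Zp
  padicZ_mulA padicZ_mulC padicZ_mul1 padicZ_mulDl padicZ_one_neq0.

Lemma residue0 k : residue (0 : Zp) k = 0.
Proof. exact: mod0z. Qed.
Lemma residueN x k : residue (- x) k = ((- residue x k) %% (p ^ k)%N)%Z.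
Proof. by []. Qed.
Lemma residueD x y k :
  residue (x + y) k = ((residue x k + residue y k) %% (p ^ k)%N)%Z.
Proof. by []. Qed.
Lemma residueM x y k :
  residue (x * y) k = ((residue x k * residue y k) %% (p ^ k)%N)%Z.
Proof. by []. Qed.

Lemma residue_le k l x : (k <= l)%N ->
  residue x k = (residue x l %% (p ^ k)%N)%Z.
Proof.
move=> kl; rewrite -(subnK kl); elim: (l - k)%N => [|n ih].
  by rewrite residue_mod.
rewrite ih [in LHS]residueP addSn.
have /dvdnP[q ->] : (p ^ k %| p ^ (n + k))%N by rewrite dvdn_exp2l// leq_addl.
rewrite {2}(divz_eq (residue x (n + k).+1) (q * p ^ k)%N) PoszM mulrA.
by rewrite modzMDl.
Qed.

Lemma residue_eq0_le k l x : (k <= l)%N -> residue x l = 0 -> residue x k = 0.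
Proof. by move=> /residue_le -> ->; rewrite mod0z. Qed.

Lemma padicZ_neq0 x : x != 0 -> exists k, residue x k.+1 != 0.
Proof.
move=> x0; apply: contrapT => /forallNP h; move/eqP: x0; apply.
apply: padicZ_eq => k; rewrite residue0.
by apply: (@residue_eq0_le k k.+1) => //; apply/eqP/negPn/negP/h.
Qed.

(* The valuation is the largest v with x in p^v Z_p; its value at 0 is junk. *)
Definition padic_val x : nat :=
  if pselect (exists k, residue x k.+1 != 0) is left h then ex_minn h else 0%N.

Definition padicZ_abs x : rat :=
  if x == 0 then 0 else (p%:R ^+ padic_val x)^-1.

Lemma padic_valP x k : x != 0 -> (k <= padic_val x)%N = (residue x k == 0).
Proof.
move=> /padicZ_neq0 x0; rewrite /padic_val; case: pselect => // h.
case: ex_minnP => v v0 vmin; apply/idP/eqP => [kv|rk0].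
  case: k kv => [|k] kv; first by rewrite residueP modz1.
  apply/eqP; apply: contraTT kv => /vmin; rewrite -leqNgt.
  by [].
rewrite leqNgt; apply: contraNN v0 => vk; apply/eqP.
exact: residue_eq0_le vk rk0.
Qed.

Lemma p_gt0 : 0 < p%:R :> rat.
Proof. by rewrite ltr0n prime_gt0. Qed.

Lemma padicZ_abs0 : padicZ_abs 0 = 0.
Proof. by rewrite /padicZ_abs eqxx. Qed.

Lemma padicZ_abs_gt0 x : (0 < padicZ_abs x) = (x != 0).
Proof.
by rewrite /padicZ_abs; case: eqVneq => _; rewrite ?ltxx// invr_gt0 exprn_gt0// p_gt0.
Qed.

Lemma padicZ_abs_ge0 x : 0 <= padicZ_abs x.
Proof.
by rewrite /padicZ_abs; case: ifP => // _; rewrite invr_ge0 exprn_ge0// ltW// p_gt0.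
Qed.

Lemma padicZ_abs_le x k :
  (padicZ_abs x <= (p%:R ^+ k)^-1) = (residue x k == 0).
Proof.
rewrite /padicZ_abs; case: (eqVneq x 0) => [->|x0].
  by rewrite residue0 eqxx invr_ge0 exprn_ge0// ltW// p_gt0.
rewrite -padic_valP// lef_pV2 ?posrE ?exprn_gt0 ?p_gt0//.
by rewrite ler_eXn2l// ltr1n prime_gt1.
Qed.

Lemma padicZ_absN x : padicZ_abs (- x) = padicZ_abs x.
Proof.
suff h y : padicZ_abs (- y) <= padicZ_abs y.
  by apply/eqP; rewrite eq_le h -{1}(opprK x) h.
case: (eqVneq y 0) => [->|y0]; first by rewrite oppr0.
rewrite [leRHS]/padicZ_abs (negbTE y0) padicZ_abs_le residueN.
have := padic_valP (padic_val y) y0; rewrite leqnn => /esym/eqP ->.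
by rewrite oppr0 mod0z.
Qed.

Lemma padicZ_absD x y :
  padicZ_abs (x + y) <= Num.max (padicZ_abs x) (padicZ_abs y).
Proof.
wlog xy : x y / padicZ_abs x <= padicZ_abs y => [h|].
  have /orP[|yx] := le_total (padicZ_abs x) (padicZ_abs y); first exact: h.
  by rewrite addrC maxC h.
rewrite le_max orbC.
case: (eqVneq y 0) xy => [->|y0 xy]; first by rewrite addr0 => ->.
have ry : padicZ_abs y = (p%:R ^+ padic_val y)^-1.
  by rewrite /padicZ_abs (negbTE y0).
rewrite ry padicZ_abs_le residueD.
move: xy; rewrite ry padicZ_abs_le => /eqP ->.
have := lexx (padicZ_abs y); rewrite [leRHS]ry padicZ_abs_le => /eqP ->.
by rewrite addr0 mod0z.
Qed.

Lemma padic_valM x y : x != 0 -> y != 0 ->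
  x * y != 0 /\ padic_val (x * y) = (padic_val x + padic_val y)%N.
Proof.
move=> x0 y0; set a := padic_val x; set b := padic_val y.
have p0 k : (p ^ k)%N != 0%N by rewrite -lt0n expn_gt0 prime_gt0.
have pz k : (p ^ k)%N%:Z != 0 by rewrite eqz_nat.
have split_residue z : z != 0 -> forall n, (padic_val z < n)%N ->
    exists2 q : int, residue z n = q * (p ^ padic_val z)%N & ~~ (p %| q)%Z.
  move=> z0 n vn.
  have := padic_valP (padic_val z) z0; rewrite leqnn (residue_le z (ltnW vn)).
  move=> /esym/eqP/dvdz_mod0P/dvdzP[q qE]; exists q => //.
  have := padic_valP (padic_val z).+1 z0; rewrite ltnn (residue_le z vn).
  move=> /esym/negbT; apply: contraNN => pq; apply/eqP/dvdz_mod0P.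
  by rewrite qE expnS PoszM dvdz_mul.
have [X XE Xp] := split_residue x x0 (a + b).+1 (leq_addr _ _).
have [Y YE Yp] := split_residue y y0 (a + b).+1 (leq_addl _ _).
have XYE : residue x (a + b).+1 * residue y (a + b).+1 =
    X * Y * (p ^ (a + b))%N by rewrite XE YE mulrACA expnD PoszM.
have XYp : ~~ (p %| X * Y)%Z.
  by move: Xp Yp; rewrite !dvdzE abszM /= Euclid_dvdM// negb_or => -> ->.
have r1 : residue (x * y) (a + b).+1 != 0.
  rewrite residueM XYE; apply: contraNN XYp => /eqP/dvdz_mod0P.
  by rewrite expnS PoszM dvdz_mul2r.
have r0 : residue (x * y) (a + b) = 0.
  rewrite (residue_le _ (leqnSn _)) residueM residue_modS XYE.
  exact: modzMl.
have xy0 : x * y != 0 by apply: contraNneq r1 => ->; rewrite residue0.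
split=> //; apply/eqP; rewrite eqn_leq (padic_valP _ xy0) r0 eqxx andbT.
by rewrite leqNgt (padic_valP _ xy0).
Qed.

Lemma padicZ_absM x y : padicZ_abs (x * y) = padicZ_abs x * padicZ_abs y.
Proof.
case: (eqVneq x 0) => [->|x0]; first by rewrite !(mul0r, padicZ_abs0).
case: (eqVneq y 0) => [->|y0]; first by rewrite !(mulr0, padicZ_abs0).
have [xy0 vxy] := padic_valM x0 y0.
by rewrite /padicZ_abs (negbTE x0) (negbTE y0) (negbTE xy0) vxy exprD invfM.
Qed.

Lemma padicZ_abs1 : padicZ_abs 1 = 1.
Proof.
have abs1_neq0 : padicZ_abs 1 != 0.
  by rewrite gt_eqF// padicZ_abs_gt0 oner_eq0.
by apply: (mulfI abs1_neq0); rewrite -padicZ_absM !mulr1.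
Qed.

Definition padicZ_unit : {pred Zp} := fun x => `[< exists y, y * x = 1 >].
Definition padicZ_inv x : Zp := xget x [set y | y * x = 1].

Fact padicZ_mulVx : {in padicZ_unit, left_inverse 1 padicZ_inv *%R}.
Proof.
move=> x /asboolP[y yx1]; rewrite /padicZ_inv.
by case: xgetP => [_ _ //|/(_ y)]; rewrite /= yx1.
Qed.
Fact padicZ_unitPl x y : y * x = 1 -> padicZ_unit x.
Proof. by move=> yx1; apply/asboolP; exists y. Qed.
Fact padicZ_inv_out : {in [predC padicZ_unit], padicZ_inv =1 id}.
Proof.
move=> x /asboolPn xN; rewrite /padicZ_inv; case: xgetP => // y _ yx1.
by exfalso; apply: xN; exists y.
Qed.

HB.instance Definition _ := GRing.ComNzRing_hasMulInverse.Build Zp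
  padicZ_mulVx padicZ_unitPl padicZ_inv_out.

Fact padicZ_idomain : GRing.integral_domain_axiom Zp.
Proof.
move=> x y xy0; apply/norP => -[x0 y0].
by have [] := padic_valM x0 y0; rewrite xy0 eqxx.
Qed.

HB.instance Definition _ := GRing.ComUnitRing_isIntegral.Build Zp padicZ_idomain.

Fact padicZ_distxx x : padicZ_abs (x - x) = 0.
Proof. by rewrite subrr padicZ_abs0. Qed.
Fact padicZ_dist_eq0 x y : padicZ_abs (x - y) = 0 -> x = y.
Proof.
move=> /eqP xy0; apply/eqP; rewrite -subr_eq0; apply: contraTT xy0.
by rewrite -padicZ_abs_gt0 => /gt_eqF ->.
Qed.
Fact padicZ_distC x y : padicZ_abs (x - y) = padicZ_abs (y - x).
Proof. by rewrite -padicZ_absN opprB. Qed.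
Fact padicZ_dist_triangle y x z :
  padicZ_abs (x - z) <= padicZ_abs (x - y) + padicZ_abs (y - z).
Proof.
rewrite -(subrKA y); apply: (le_trans (padicZ_absD _ _)).
by rewrite ge_max lerDl lerDr !padicZ_abs_ge0.
Qed.

HB.instance Definition _ := isPointed.Build Zp 0.
HB.instance Definition _ := @isMetric.Build rat Zp
  (fun x y => padicZ_abs (x - y))
  padicZ_distxx padicZ_dist_eq0 padicZ_distC padicZ_dist_triangle.

End PadicIntegers.

Definition padicQ p (hp : prime p) := {fraction padicZ hp}.

HB.instance Definition _ p (hp : prime p) := GRing.Field.on (padicQ hp).

Section PadicNumbers.
Context {p : nat} {hp : prime p}.
Local Notation Zp := (padicZ hp).
Local Notation Qp := (padicQ hp).
Implicit Types (x y : Qp) (a b c d : Zp).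

Definition toQp (a : Zp) : Qp := FracField.tofrac a.

HB.instance Definition _ := GRing.RMorphism.copy toQp (@FracField.tofrac Zp).

Definition padicQ_abs x : rat :=
  padicZ_abs (frac (repr x)).1 / padicZ_abs (frac (repr x)).2.

Lemma toQp_eq0 a : (toQp a == 0) = (a == 0).
Proof. exact: tofrac_eq0. Qed.

Lemma padicQ_fracE x : x = toQp (frac (repr x)).1 / toQp (frac (repr x)).2.
Proof.
case: (repr x) (reprK x) => -[n d] /= d0 <-; rewrite /toQp.
rewrite /FracField.tofrac; unlock.
rewrite -[X in _ * X]FracField.pi_inv -[RHS]FracField.pi_mul.
rewrite /FracField.mulf /FracField.invf !numden_Ratio ?oner_eq0//.
rewrite mulr1 mul1r; congr (\pi_(_)%qT _).
by apply: val_inj; rewrite /= /Ratio /insubd insubT.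
Qed.

Lemma padicQ_absE a b : b != 0 ->
  padicQ_abs (toQp a / toQp b) = padicZ_abs a / padicZ_abs b.
Proof.
move=> b0; rewrite /padicQ_abs; set x := toQp a / toQp b.
have d0 : (frac (repr x)).2 != 0 by exact: denom_ratioP.
have := padicQ_fracE x; set n := _.1; set d := (frac _).2 in d0 *.
rewrite /x => /eqP; rewrite eqr_div ?toQp_eq0// -!rmorphM/=.
rewrite /toQp tofrac_eq => /eqP adnb.
have abs_neq0 (c : Zp) : c != 0 -> padicZ_abs c != 0 by rewrite -padicZ_abs_gt0 => /gt_eqF ->.
apply/eqP; rewrite eqr_div ?abs_neq0//.
by rewrite -!padicZ_absM -adnb.
Qed.

Lemma padicQ_ind (P : Qp -> Prop) :
  (forall a b, b != 0 -> P (toQp a / toQp b)) -> forall x, P x.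
Proof. by move=> h x; rewrite (padicQ_fracE x); apply/h/denom_ratioP. Qed.

Lemma padicQ_abs_toQp a : padicQ_abs (toQp a) = padicZ_abs a.
Proof.
rewrite -[toQp a]divr1 -(rmorph1 toQp) padicQ_absE ?oner_eq0//.
by rewrite padicZ_abs1 divr1.
Qed.

Lemma padicQ_abs0 : padicQ_abs 0 = 0.
Proof. by rewrite -(rmorph0 toQp) padicQ_abs_toQp padicZ_abs0. Qed.

Lemma padicQ_abs_ge0 x : 0 <= padicQ_abs x.
Proof. by rewrite /padicQ_abs divr_ge0// padicZ_abs_ge0. Qed.

Lemma padicQ_abs_gt0 x : (0 < padicQ_abs x) = (x != 0).
Proof.
apply/idP/idP => [|x0]; first by apply: contraTneq => ->; rewrite padicQ_abs0 ltxx.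
rewrite /padicQ_abs divr_gt0 ?padicZ_abs_gt0 ?denom_ratioP//.
by apply: contraNneq x0 => n0; rewrite (padicQ_fracE x) n0 rmorph0 mul0r.
Qed.

Lemma padicQ_absN x : padicQ_abs (- x) = padicQ_abs x.
Proof.
elim/padicQ_ind: x => a b b0.
by rewrite -mulNr -rmorphN !padicQ_absE// padicZ_absN.
Qed.

Lemma padicQ_absM x y : padicQ_abs (x * y) = padicQ_abs x * padicQ_abs y.
Proof.
elim/padicQ_ind: x => a b b0; elim/padicQ_ind: y => c d d0.
rewrite mulf_div -!rmorphM !padicQ_absE ?mulf_neq0//.
by rewrite mulf_div !padicZ_absM.
Qed.

Lemma padicQ_absD x y :
  padicQ_abs (x + y) <= Num.max (padicQ_abs x) (padicQ_abs y).
Proof.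
elim/padicQ_ind: x => a b b0; elim/padicQ_ind: y => c d d0.
have abs_gt0 (e : Zp) : e != 0 -> 0 < padicZ_abs e by rewrite padicZ_abs_gt0.
have abs_neq0 (e : Zp) : e != 0 -> padicZ_abs e != 0 by move=> /abs_gt0 /gt_eqF ->.
rewrite addf_div ?toQp_eq0// -!rmorphM -rmorphD !padicQ_absE ?mulf_neq0//.
rewrite padicZ_absM ler_pdivrMr ?mulr_gt0 ?abs_gt0//.
rewrite maxr_pMl ?mulr_ge0 ?padicZ_abs_ge0//.
apply: (le_trans (padicZ_absD _ _)); rewrite !padicZ_absM.
rewrite mulrA divfK ?abs_neq0// [padicZ_abs b * _]mulrC mulrA divfK ?abs_neq0//.
Qed.

Fact padicQ_distxx x : padicQ_abs (x - x) = 0.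
Proof. by rewrite subrr padicQ_abs0. Qed.
Fact padicQ_dist_eq0 x y : padicQ_abs (x - y) = 0 -> x = y.
Proof.
move=> /eqP xy0; apply/eqP; rewrite -subr_eq0; apply: contraTT xy0.
by rewrite -padicQ_abs_gt0 => /gt_eqF ->.
Qed.
Fact padicQ_distC x y : padicQ_abs (x - y) = padicQ_abs (y - x).
Proof. by rewrite -padicQ_absN opprB. Qed.
Fact padicQ_dist_triangle y x z :
  padicQ_abs (x - z) <= padicQ_abs (x - y) + padicQ_abs (y - z).
Proof.
rewrite -(subrKA y); apply: (le_trans (padicQ_absD _ _)).
by rewrite ge_max lerDl lerDr !padicQ_abs_ge0.
Qed.

HB.instance Definition _ := isPointed.Build Qp 0.
HB.instance Definition _ := @isMetric.Build rat Qp
  (fun x y => padicQ_abs (x - y))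
  padicQ_distxx padicQ_dist_eq0 padicQ_distC padicQ_dist_triangle.

End PadicNumbers.

Section UltrametricCk.
Context {p : nat} {hp : prime p} {d : nat}.
Local Notation Zp := (padicZ hp).
Local Notation Qp := (padicQ hp).

Definition set_coord (i : 'I_d) (a : Zp) (x : 'rV[Zp]_d) : 'rV[Zp]_d :=
  \row_j (if j == i then a else x ord0 j).

(* First difference quotient in the variable i, with second node a. Iterating
   it in the same variable gives the higher order difference quotients: the
   divided differences of g at the nodes x_i, a, b, ... *)
Definition diff_quot (i : 'I_d) (a : Zp) (g : 'rV[Zp]_d -> Qp) :
    'rV[Zp]_d -> Qp :=
  fun x => (g x - g (set_coord i a x)) / toQp (x ord0 i - a).

(* Phi_beta h for the multi-index beta with beta_i = #|{l | s l = i}|; the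
   nodes of the variable i are x_i and the a_l with s l = i. *)
Definition mdiff_quot k (s : 'I_k -> 'I_d) (h : 'rV[Zp]_d -> Zp)
    (xa : 'rV[Zp]_d * 'rV[Zp]_k) : Qp :=
  foldr (fun l g => diff_quot (s l) (xa.2 ord0 l) g) (fun x => toQp (h x))
    (enum 'I_k) xa.1.

(* Tuples of nodes whose whole grid lies in U, so that mdiff_quot only uses the
   values of h on U. For U = U_1 x ... x U_d this is
   U_1^(beta_1 + 1) x ... x U_d^(beta_d + 1). *)
Definition diff_quot_dom k (s : 'I_k -> 'I_d) (U : set 'rV[Zp]_d) :
    set ('rV[Zp]_d * 'rV[Zp]_k) :=
  [set xa : 'rV[Zp]_d * 'rV[Zp]_k | forall y : 'rV[Zp]_d,
    (forall i, y ord0 i = xa.1 ord0 i \/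
       exists2 l, s l = i & y ord0 i = xa.2 ord0 l) -> U y].

(* In each variable, the nodes are pairwise distinct. *)
Definition distinct_nodes k (s : 'I_k -> 'I_d) :
    set ('rV[Zp]_d * 'rV[Zp]_k) :=
  [set xa : 'rV[Zp]_d * 'rV[Zp]_k | (forall l, xa.2 ord0 l <> xa.1 ord0 (s l)) /\
    (forall l l', l <> l' -> s l = s l' -> xa.2 ord0 l <> xa.2 ord0 l')].

(* All difference quotients of order at most k extend continuously to the
   diagonals (Schikhof; Kleinbock-Tomanov in several variables). *)
Definition is_Ck (k : nat) (U : set 'rV[Zp]_d) (h : 'rV[Zp]_d -> Zp) :=
  forall j (s : 'I_j -> 'I_d), (j <= k)%N ->
    exists phi : 'rV[Zp]_d * 'rV[Zp]_j -> Qp,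
      {within diff_quot_dom s U, continuous phi} /\
      forall xa, diff_quot_dom s U xa -> distinct_nodes s xa ->
        phi xa = mdiff_quot s h xa.

Definition is_Ck_map m (k : nat) (U : set 'rV[Zp]_d)
    (f : 'rV[Zp]_d -> 'rV[Zp]_m) :=
  forall j, is_Ck k U (fun x => f x ord0 j).

End UltrametricCk.

Definition padic_borel p (hp : prime p) (d : nat) :=
  g_sigma_algebraType (@open 'rV[padicZ hp]_d).

HB.instance Definition _ p (hp : prime p) d := Measurable.on (padic_borel hp d).

(* Together with total mass 1, which is part of the type of mu, this
   characterizes the normalized Haar measure on Z_p^d. *)
Definition translation_invariant p (hp : prime p) (d : nat) (R : realType)
    (mu : probability (padic_borel hp d) R) :=
  forall (t : 'rV[padicZ hp]_d) (A : set (padic_borel hp d)), measurable A ->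
    mu [set t + x | x in (A : set 'rV[padicZ hp]_d)] = mu A.

Section WeightedApproximation.
Context {p : nat} {hp : prime p} {R : realType} {n : nat}.
Implicit Types (b : 'rV[int]_n.+1) (y : 'rV[padicZ hp]_n) (tau : 'I_n -> R).

Definition height b : nat := \max_(i < n.+1) `|b ord0 i|%N.

Definition approx_by (c : R) tau y b :=
  (* |b_0 y_i - b_i|_p < c ||b||^(- tau_i), where y and tau are indexed from 0
     and b_0 is the first entry of b *)
  forall i : 'I_n,
    ratr (padicZ_abs ((b ord0 ord0)%:~R * y ord0 i
                      - (b ord0 (lift ord0 i))%:~R)) <
    c * (height b)%:R `^ (- tau i).

Definition W (c : R) tau : set 'rV[padicZ hp]_n :=
  [set y | infinite_set [set b | approx_by c tau y b]].

Definition Bad tau : set 'rV[padicZ hp]_n :=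
  W 1 tau `\` \bigcap_(k in [set k : nat | (0 < k)%N]) W k%:R^-1 tau.

End WeightedApproximation.

(* Main.v *)
Require Import Defs.
From mathcomp Require Import all_boot all_order all_algebra.
From mathcomp Require Import all_classical all_reals all_analysis.
From mathcomp Require Import zify ring lra.

Set Implicit Arguments.
Unset Strict Implicit.
Unset Printing Implicit Defensive.

Import Order.TTheory GRing.Theory Num.Theory.

Local Open Scope classical_set_scope.
Local Open Scope ring_scope.

(* Approximations b with p not dividing b_0 and of height h lie in boxes with
   sides about h^(- tau_i).  The boxes with sides p^(s - floor (log_p (h^tau_i)))
   form, as h grows, a nested sequence of partitions of Z_p^d.  Hence a closed
   set E is null as soon as every point of E lies in arbitrarily late boxes of
   this sequence of which a fixed proportion is disjoint from E.

   Such boxes exist for the set E of the points x of U for which no b of height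
   at least H satisfies the inequalities with constant 1/k.  Near a point of U
   the increments of v f, for some v <> 0, agree with those of a linear map u up
   to a small multiple of the increment of x.  By the pigeonhole principle there
   is b with b_0 x_i - b_i small and v (b_0 f_j(x) - b_(d+j)) -
   sum_i u_ji (b_0 x_i - b_i) very small; the gain in these last m forms is paid
   for by a bounded loss s in the first d forms.  If z is so close to the point
   b_i / b_0 that all b_0 z_i - b_i are very small, then so are the
   b_0 f_j(z) - b_(d+j), because tau_(d+j) <= tau_i controls the linearization
   error.  These z form a box of fixed proportion in the box of x.  Common
   factors p of b can be divided out because tau_i > 1. *)

(** * Divisibility by powers of p in Z_p *)

Lemma pexp_gt0 (p : nat) (hp : prime p) k : 0 < p%:R ^+ k :> rat.
Proof. by rewrite exprn_gt0// ltr0n prime_gt0. Qed.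

Section Divisibility.
Context {p : nat} {hp : prime p}.
Local Notation Zp := (padicZ hp).
Implicit Types (x y z : Zp) (k l : nat).

(** Membership in p^k Z_p, that is |z|_p <= p^(-k). In this form p-adic estimates become
    inequalities between natural exponents. *)
Definition pdvd k z := residue z k == 0.

Lemma pdvdE k z : pdvd k z = (padicZ_abs z <= (p%:R ^+ k)^-1).
Proof. by rewrite padicZ_abs_le. Qed.


Lemma pdvd_le k l z : (k <= l)%N -> pdvd l z -> pdvd k z.
Proof. by move=> kl /eqP h; apply/eqP/(residue_eq0_le kl). Qed.

Lemma pdvd0 k : pdvd k 0.
Proof. by rewrite /pdvd residue0. Qed.

Lemma pdvd_level0 z : pdvd 0 z.
Proof. by rewrite /pdvd residueP modz1. Qed.

Lemma pdvdD k x y : pdvd k x -> pdvd k y -> pdvd k (x + y).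
Proof. by move=> /eqP hx /eqP hy; rewrite /pdvd residueD hx hy mod0z. Qed.

Lemma pdvdN k x : pdvd k (- x) = pdvd k x.
Proof. by rewrite !pdvdE padicZ_absN. Qed.

Lemma pdvdB k x y : pdvd k x -> pdvd k y -> pdvd k (x - y).
Proof. by move=> hx hy; apply: pdvdD; rewrite ?pdvdN. Qed.

Lemma pdvdDr k x y : pdvd k x -> pdvd k (x + y) = pdvd k y.
Proof.
move=> hx; apply/idP/idP => [h|]; last exact: pdvdD.
by rewrite -(addKr x y) pdvdD// pdvdN.
Qed.

Lemma pdvd_distC k x y : pdvd k (x - y) = pdvd k (y - x).
Proof. by rewrite -pdvdN opprB. Qed.

Lemma pdvd_trans k y x z : pdvd k (x - y) -> pdvd k (y - z) -> pdvd k (x - z).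
Proof. by move=> xy yz; rewrite -(subrKA y) pdvdD. Qed.

Lemma pdvdMr k x y : pdvd k y -> pdvd k (x * y).
Proof. by move=> /eqP h; rewrite /pdvd residueM h mulr0 mod0z. Qed.

Lemma pdvd_sum k (I : Type) (r : seq I) (P : pred I) (F : I -> Zp) :
  (forall i, P i -> pdvd k (F i)) -> pdvd k (\sum_(i <- r | P i) F i).
Proof. by move=> h; elim/big_ind: _ => //; [exact: pdvd0|exact: pdvdD]. Qed.

Lemma pdvd_eqr k x y : (residue x k = residue y k) <-> pdvd k (x - y).
Proof.
split=> [h|].
  by rewrite /pdvd residueD residueN h modzDmr subrr mod0z.
move=> h; have : residue (y + (x - y)) k = residue x k by rewrite addrC subrK.
by rewrite residueD (eqP h) addr0 residue_mod.
Qed.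

Lemma pdvdM_val k z v : v != 0 -> pdvd (k + padic_val v) (v * z) = pdvd k z.
Proof.
move=> v0; rewrite !pdvdE padicZ_absM exprD invfM {1}/padicZ_abs (negbTE v0).
by rewrite [leRHS]mulrC ler_pM2l// invr_gt0 (pexp_gt0 hp).
Qed.

Lemma residue_int (a : int) k : residue (a%:~R : Zp) k = (a %% (p ^ k)%N)%Z.
Proof.
have hn (n : nat) : residue (n%:R : Zp) k = (n %% (p ^ k)%N)%Z.
  elim: n => [|n ih]; first by rewrite residue0 mod0z.
  rewrite -natr1 residueD ih -[X in _ + X]/((1 %% _)%Z) modzDm.
  by rewrite -addn1 PoszD.
case: a => n; first exact: hn.
by rewrite NegzE mulrNz residueN hn modzNm.
Qed.

Lemma pdvd_int (a : int) k : pdvd k (a%:~R : Zp) = ((p ^ k)%N %| a)%Z.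
Proof. by rewrite /pdvd residue_int; apply/eqP/idP => /dvdz_mod0P. Qed.

Lemma padic_val_pexp k : (p%:R ^+ k : Zp) != 0 /\ padic_val (p%:R ^+ k : Zp) = k.
Proof.
have h j : pdvd j (p%:R ^+ k : Zp) = (j <= k)%N.
  rewrite -natrX -(dvdn_Pexp2l j k (prime_gt1 hp)).
  by rewrite -[_%:R]/((Posz (p ^ k))%:~R) pdvd_int.
have nz : (p%:R ^+ k : Zp) != 0.
  by apply: contraFneq (ltnn k) => z; rewrite -h z pdvd0.
split=> //; apply/eqP; rewrite eqn_leq leqNgt.
by rewrite !(padic_valP _ nz) -![_ == 0]/(pdvd _ _) !h ltnn leqnn.
Qed.

Lemma pdvdM_pexp k l z : pdvd (k + l) (p%:R ^+ l * z) = pdvd k z.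
Proof. by have [nz {1}<-] := padic_val_pexp l; rewrite pdvdM_val. Qed.

End Divisibility.

(** * Boxes in Z_p^d and their topology *)

Lemma pexpV_lt (F : archiRealFieldType) (p : nat) (e : F) :
  (1 < p)%N -> 0 < e -> exists k, (p%:R ^+ k)^-1 < e.
Proof.
move=> p1 e0; exists (Num.truncn e^-1).+1.
rewrite -[ltRHS]invrK ltf_pV2 ?posrE ?invr_gt0 ?exprn_gt0 ?ltr0n ?(ltnW p1)//.
apply: (lt_trans (truncnS_gt _)); rewrite -natrX ltr_nat.
exact: ltn_expl.
Qed.

Section Cells.
Context {p : nat} {hp : prime p} {d : nat}.
Local Notation Zp := (padicZ hp).
Implicit Types (x y z : 'rV[Zp]_d) (K : 'I_d -> nat) (A : set 'rV[Zp]_d).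

(** The sides p^(- K i) may differ between coordinates, as the weights do. Boxes of one shape are
    congruence classes, hence equal or disjoint. *)
Definition cell K x : set 'rV[Zp]_d :=
  [set y | forall i, pdvd (K i) (y ord0 i - x ord0 i)].

Lemma cell_refl K x : cell K x x.
Proof. by move=> i; rewrite subrr pdvd0. Qed.

Lemma cell_sym K x y : cell K x y -> cell K y x.
Proof. by move=> h i; rewrite pdvd_distC. Qed.

Lemma cell_trans K x y z : cell K x y -> cell K y z -> cell K x z.
Proof. by move=> xy yz i; apply: pdvd_trans (yz i) (xy i). Qed.

Lemma cell_le K K' x : (forall i, (K i <= K' i)%N) -> cell K' x `<=` cell K x.
Proof. by move=> KK y h i; apply: pdvd_le (h i). Qed.

Lemma nbhs_cellP x A :
  nbhs x A <-> exists k, cell (fun=> k) x `<=` A.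
Proof.
split=> [/nbhs_ballP[e /= e0 xeA]|[k xkA]].
  have [k ke] := pexpV_lt (prime_gt1 hp) e0; exists k => y xy.
  apply: xeA; split=> // i j; rewrite (ord1 i) /ball /=.
  by apply: le_lt_trans ke; rewrite -pdvdE pdvd_distC.
apply/nbhs_ballP; exists (p%:R ^+ k)^-1.
  by rewrite /= invr_gt0 (pexp_gt0 hp).
move=> y [_ xy]; apply: xkA => i; rewrite pdvdE padicZ_distC.
exact/ltW/(xy ord0 i).
Qed.

Lemma open_cellP A :
  open A <-> forall x, A x -> exists k, cell (fun=> k) x `<=` A.
Proof.
split=> [oA x Ax|h]; first by apply/nbhs_cellP; move: oA; rewrite openE; apply.
by rewrite openE => x Ax; apply/nbhs_cellP/h.
Qed.

Lemma saturated_open K A : (forall x, A x -> cell K x `<=` A) -> open A.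
Proof.
move=> h; apply/open_cellP => x Ax; exists (\max_i K i)%N.
by apply: subset_trans (h x Ax); apply: cell_le => i; apply: leq_bigmax.
Qed.

Lemma open_cell K x : open (cell K x).
Proof. by apply: (@saturated_open K) => y xy z; apply: cell_trans xy. Qed.

End Cells.

(** * Strict differentiability of C^k maps *)

Section StrictDifferentiability.
Context {p : nat} {hp : prime p} {d : nat}.
Local Notation Zp := (padicZ hp).
Local Notation Qp := (padicQ hp).
Implicit Types (x y z : 'rV[Zp]_d).

(** The continuous extension of the difference quotient in the variable i takes a value u / v at
    (x0, x0_i). Nearby quotients are within p^(-r) of it; multiplying by v (x_i - a) gives the
    exponent e + r, with l independent of e. *)
Lemma Ck_diff_quot (k : nat) (U : set 'rV[Zp]_d) (h : 'rV[Zp]_d -> Zp)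
    x0 (i : 'I_d) : (1 <= k)%N -> open U -> is_Ck k U h -> U x0 ->
  exists v u : Zp, v != 0 /\ forall r, exists l, cell (fun=> l) x0 `<=` U /\
    forall x a e, cell (fun=> l) x0 x -> pdvd l (a - x0 ord0 i) ->
      pdvd e (x ord0 i - a) ->
      pdvd (e + r) (v * (h x - h (set_coord i a x)) - u * (x ord0 i - a)).
Proof.
move=> k1 oU hC Ux0.
have [phi [cphi phiE]] := hC 1%N (fun=> i) k1.
pose a0 : 'rV[Zp]_1 := const_mx (x0 ord0 i).
have dom0 : diff_quot_dom (fun _ : 'I_1 => i) U (x0, a0).
  move=> y hy; suff -> : y = x0 by [].
  apply/rowP => i'; have [//|[l si' ->]] := hy i'.
  by rewrite mxE /= si'.
have [u0 [v0 [v00 phi0]]] : exists u v : Zp, v != 0 /\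
    phi (x0, a0) = toQp u / toQp v.
  by move: (phi _); apply: padicQ_ind => a b b0; exists a, b.
exists v0, u0; split=> // r.
have [l0 l0U] : exists l, cell (fun=> l) x0 `<=` U.
  by move/open_cellP: oU; apply.
move/subspace_continuousP: cphi => /(_ _ dom0) /cvg_ballP.
move=> /(_ (p%:R ^+ r)^-1); rewrite invr_gt0 (pexp_gt0 hp) => /(_ isT).
case=> -[P Q] /= [nP nQ] PQ.
have [/nbhs_cellP[l1 l1P] /nbhs_cellP[l2 l2Q]] : nbhs x0 P /\ nbhs a0 Q by [].
pose l := maxn l0 (maxn l1 l2); exists l.
have ll0 : (l0 <= l)%N by rewrite leq_maxl.
have ll1 : (l1 <= l)%N by rewrite !leq_max leqnn orbT.
have ll2 : (l2 <= l)%N by rewrite !leq_max leqnn !orbT.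
have lU : cell (fun=> l) x0 `<=` U.
  by apply: subset_trans l0U; apply: cell_le.
split=> // x a e xl al xae.
(* On the diagonal no quotient is available, but both increments vanish. *)
have [xa|xa] := eqVneq (x ord0 i) a.
  suff -> : set_coord i a x = x by rewrite -xa !subrr !mulr0 subrr pdvd0.
  by apply/rowP => j; rewrite mxE; case: eqVneq => // ->.
have domx : diff_quot_dom (fun _ : 'I_1 => i) U (x, const_mx a).
  move=> y hy; apply: lU => j.
  by have [->|[q <- ->]] := hy j; [exact: xl|rewrite mxE].
have disx : distinct_nodes (fun _ : 'I_1 => i) (x, const_mx a : 'rV[Zp]_1).
  split=> [q|q q']; first by rewrite mxE => /esym/eqP; apply/negP.
  by rewrite (ord1 q) (ord1 q').
have := PQ (x, const_mx a); rewrite /= => /(_ _ domx).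
rewrite /from_subspace (phiE _ domx disx) /mdiff_quot enum_ordSl enum_ord0 /=.
rewrite /diff_quot mxE.
rewrite phi0 -!rmorphB/= => near_phi.
have {near_phi} : ball (toQp u0 / toQp v0) (p%:R ^+ r)^-1
    (toQp (h x - h (set_coord i a x)) / toQp (x ord0 i - a) : Qp).
  apply: near_phi; split.
    by apply: l1P => j; apply: pdvd_le (xl j).
  by apply: l2Q => j; rewrite !mxE; apply: pdvd_le al.
have xa0 : x ord0 i - a != 0 by rewrite subr_eq0.
rewrite /ball /= -mulNr addf_div ?toQp_eq0// -rmorphN -!rmorphM -rmorphD.
rewrite padicQ_absE ?mulf_neq0//.
rewrite ltr_pdivrMr ?padicZ_abs_gt0 ?mulf_neq0// => num_lt.
rewrite pdvdE padicZ_distC (_ : _ - _ = u0 * (x ord0 i - a) +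
  - (h x - h (set_coord i a x)) * v0); last by ring.
apply: (le_trans (ltW num_lt)); rewrite exprD invfM mulrC ler_pM2r//.
  rewrite padicZ_absM -[leRHS]mul1r ler_pM ?padicZ_abs_ge0//.
    by have := pdvd_level0 v0; rewrite pdvdE expr0 invr1.
  by rewrite -pdvdE.
by rewrite invr_gt0 (pexp_gt0 hp).
Qed.

(** Moving from x to y one coordinate at a time splits the increment into d partial ones, and the
    ultrametric inequality bounds the total error by the worst of theirs. *)
Lemma Ck_strictly_differentiable (k m : nat) (U : set 'rV[Zp]_d)
    (f : 'rV[Zp]_d -> 'rV[Zp]_m) x0 :
  (1 <= k)%N -> open U -> is_Ck_map k U f -> U x0 ->
  exists (v : Zp) (u : 'I_m -> 'I_d -> Zp), v != 0 /\
    forall r, exists l, cell (fun=> l) x0 `<=` U /\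
      forall x y e, cell (fun=> l) x0 x -> cell (fun=> l) x0 y ->
        cell (fun=> e) y x -> forall j,
        pdvd (e + r) (v * (f x ord0 j - f y ord0 j) -
                      \sum_i u j i * (x ord0 i - y ord0 i)).
Proof.
move=> k1 oU fC Ux0.
have /choice[vu vuP] : forall ji : 'I_m * 'I_d, exists vu : Zp * Zp,
    vu.1 != 0 /\ forall r, exists l, cell (fun=> l) x0 `<=` U /\
    forall x a e, cell (fun=> l) x0 x -> pdvd l (a - x0 ord0 ji.2) ->
      pdvd e (x ord0 ji.2 - a) ->
      pdvd (e + r) (vu.1 * (f x ord0 ji.1 - f (set_coord ji.2 a x) ord0 ji.1)
                    - vu.2 * (x ord0 ji.2 - a)).
  move=> [j i].
  by have [v [u h]] := Ck_diff_quot i k1 oU (fC j) Ux0; exists (v, u).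
(* [w ji] is the product of the other denominators: multiplying the estimate for [ji] by it produces
   the common [v]. *)
pose w ji := \prod_(ji' | ji' != ji) (vu ji').1.
exists (\prod_ji (vu ji).1), (fun j i => w (j, i) * (vu (j, i)).2); split.
  by apply/prodf_neq0 => ji _; have [] := vuP ji.
move=> r.
have /choice[l lP] : forall ji : 'I_m * 'I_d, exists l,
    forall x a e, cell (fun=> l) x0 x -> pdvd l (a - x0 ord0 ji.2) ->
      pdvd e (x ord0 ji.2 - a) ->
      pdvd (e + r) ((vu ji).1 * (f x ord0 ji.1 -
                                 f (set_coord ji.2 a x) ord0 ji.1)
                    - (vu ji).2 * (x ord0 ji.2 - a)).
  by move=> ji; have [_ /(_ r)[l [_ h]]] := vuP ji; exists l.
have [l0 l0U] : exists l, cell (fun=> l) x0 `<=` U.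
  by move/open_cellP: oU; apply.
pose L := maxn l0 (\max_ji l ji); exists L.
have Ll0 : (l0 <= L)%N by rewrite leq_maxl.
have Ll ji : (l ji <= L)%N by rewrite leq_max (leq_bigmax ji) orbT.
split; first by apply: subset_trans l0U; apply: cell_le.
move=> x y e xL yL xye j.
(* [mix n] takes its first n coordinates from y and the others from x. *)
pose mix n : 'rV[Zp]_d := \row_i (if (i < n)%N then y ord0 i else x ord0 i).
have mixS (i : 'I_d) : mix i.+1 = set_coord i (y ord0 i) (mix i).
  apply/rowP => i'; rewrite !mxE ltnS leq_eqVlt -val_eqE /=.
  by case: (eqVneq (i' : nat) i) => //= /val_inj ->.
have mixi (i : 'I_d) : mix i ord0 i = x ord0 i by rewrite mxE ltnn.
have -> : f x ord0 j - f y ord0 j =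
    \sum_(i < d) (f (mix i) ord0 j - f (mix i.+1) ord0 j).
  have -> : x = mix 0%N by apply/rowP => i; rewrite mxE.
  have -> : y = mix d by apply/rowP => i; rewrite mxE ltn_ord.
  rewrite -opprB -(telescope_sumr (fun n => f (mix n) ord0 j) (leq0n d)).
  by rewrite -sumrN big_mkord; apply: eq_bigr => i _; rewrite opprB.
rewrite mulr_sumr -sumrB; apply: pdvd_sum => i _.
rewrite (bigD1 (j, i)) //= -/(w (j, i)) mixS.
rewrite [X in X * _ - _]mulrC -!mulrA -mulrBr -(mixi i); apply: pdvdMr.
apply: (lP (j, i)) => /=.
- move=> i'; rewrite mxE; apply: pdvd_le (Ll _) _.
  by case: ifP => _; [exact: yL|exact: xL].
- by apply: pdvd_le (Ll _) (yL i).
- by rewrite mixi; apply: xye.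
Qed.

End StrictDifferentiability.

(** * Integer exponents for the powers h^t of the height *)

Section Kappa.
Context {R : realType} {p : nat} (p1 : (1 < p)%N).
Implicit Types (t : R) (h k : nat).

(** For h > 0 and t >= 0 this is floor (log_p (h^t)), so h^t is replaced by a power of p up to a
    factor p. *)
Definition kappa t h : nat := trunc_log p (Num.truncn ((h%:R : R) `^ t)).

Lemma leq_kappa t h k : 0 <= t -> (0 < h)%N ->
  (k <= kappa t h)%N = ((p%:R : R) ^+ k <= h%:R `^ t).
Proof.
move=> t0 h0; rewrite -natrX.
have ht1 : 1 <= (h%:R : R) `^ t.
  by rewrite -[leLHS](powRr0 (h%:R : R)) ler_powR// ler1n.
have tr0 : (0 < Num.truncn ((h%:R : R) `^ t))%N by rewrite truncn_gt0.
rewrite -truncn_ge_nat ?powR_ge0//; apply/idP/idP => [kk|].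
  by apply: leq_trans (trunc_logP p1 tr0); rewrite leq_exp2l.
exact: trunc_log_max.
Qed.

Lemma pexp_kappa t h : 0 <= t -> (0 < h)%N ->
  (p%:R : R) ^+ kappa t h <= h%:R `^ t.
Proof. by move=> t0 h0; rewrite -leq_kappa. Qed.

Lemma kappa_lt t h : 0 <= t -> (0 < h)%N ->
  h%:R `^ t < (p%:R : R) ^+ (kappa t h).+1.
Proof. by move=> t0 h0; rewrite ltNge -leq_kappa// ltnn. Qed.

Lemma leq_kappa_height t h h' : 0 <= t -> (h <= h')%N ->
  (kappa t h <= kappa t h')%N.
Proof.
move=> t0 hh'; have [->|h0] := posnP h.
  rewrite /kappa; have [->|tN0] := eqVneq t 0.
    by rewrite powRr0 truncn1 trunc_log1.
  by rewrite powR0// truncn0 trunc_log0.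
rewrite leq_kappa// ?(leq_trans h0)//.
apply: (le_trans (pexp_kappa t0 h0)).
by rewrite ge0_ler_powR ?nnegrE ?ler_nat.
Qed.

Lemma leq_kappa_weight t t' h : 0 <= t -> t <= t' -> (0 < h)%N ->
  (kappa t h <= kappa t' h)%N.
Proof.
move=> t0 tt' h0; rewrite leq_kappa// ?(le_trans t0)//.
by apply: (le_trans (pexp_kappa t0 h0)); rewrite ler_powR// ler1n.
Qed.

(** Dividing p^k out of an integer vector costs k in divisibility; as t >= 1, the exponent required
    at the smaller height drops by at least k as well. *)
Lemma kappaD t h h' k : 1 <= t -> (0 < h)%N -> (h * p ^ k <= h')%N ->
  (kappa t h + k <= kappa t h')%N.
Proof.
move=> t1 h0 hh'.
have t0 : 0 <= t by apply: le_trans t1.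
have pk0 : (0 < p ^ k)%N by rewrite expn_gt0 ltnW.
have h'0 : (0 < h')%N by apply: leq_trans hh'; rewrite muln_gt0 h0.
rewrite leq_kappa// exprD.
apply: (@le_trans _ _ ((h * p ^ k)%:R `^ t)); last first.
  by rewrite ge0_ler_powR ?nnegrE ?ler_nat.
rewrite natrM powRM//; apply: ler_pM; rewrite ?exprn_ge0 ?pexp_kappa//.
by rewrite -natrX -[leLHS]powRr1// ler_powR// ler1n.
Qed.

(** N^(t_i) exceeds N by the factor N^(t_i - 1), which is unbounded because t_i > 1. *)
Lemma kappa_large (I : finType) (t : I -> R) (M : nat) : (forall i, 1 < t i) ->
  exists N0, forall N, (N0 <= N)%N -> (0 < N)%N ->
    forall i, (trunc_log p N + M <= kappa (t i) N)%N.
Proof.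
move=> t1.
pose B i := (Num.truncn ((p%:R ^+ M : R) `^ (t i - 1)^-1)).+1.
exists (\max_i B i)%N => N BN N0 i.
have ti0 : 0 < t i - 1 by rewrite subr_gt0.
rewrite leq_kappa ?(ltW (lt_trans ltr01 (t1 i)))// exprD.
rewrite -[t i](subrK 1) addrC powRD; last by rewrite pnatr_eq0 -lt0n N0 implybT.
rewrite powRr1//; apply: ler_pM; rewrite ?exprn_ge0//.
  by rewrite -natrX ler_nat trunc_logP.
have pM0 : 0 <= (p%:R ^+ M : R) by rewrite exprn_ge0.
rewrite -[leLHS]powRr1// -[X in _ `^ X](mulVf (lt0r_neq0 ti0)) powRrM.
rewrite ge0_ler_powR ?nnegrE ?powR_ge0 ?ler0n ?(ltW ti0)//.
apply/ltW/(lt_le_trans (truncnS_gt _)); rewrite ler_nat.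
by apply: leq_trans BN; apply: (leq_bigmax (F := B) i).
Qed.

Lemma kappa_sum (I : finType) (t : I -> R) (q N : nat) :
  (forall i, 0 <= t i) -> \sum_i t i = q%:R -> (0 < N)%N ->
  (p ^ (\sum_i kappa (t i) N) <= N ^ q)%N.
Proof.
move=> t0 tq N0; rewrite -(ler_nat R) !natrX -[leRHS]powR_mulrn// -tq.
rewrite (big_morph (fun k => (p%:R : R) ^+ k) (exprD _) (expr0 _)).
have -> : (N%:R : R) `^ (\sum_i t i) = \prod_i N%:R `^ t i.
  apply: (big_morph (fun s => (N%:R : R) `^ s)); last exact: powRr0.
  by move=> a b; rewrite powRD// pnatr_eq0 -lt0n N0 implybT.
by apply: ler_prod => i _; rewrite exprn_ge0//= pexp_kappa.
Qed.

End Kappa.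

(** * Heights and a Dirichlet theorem *)

Lemma heightZ (n : nat) (c : int) (b : 'rV[int]_n.+1) :
  height (c *: b) = (`|c| * height b)%N.
Proof.
rewrite /height (big_morph (muln `|c|%N) (maxnMr _) (muln0 _)).
by apply: eq_bigr => i _; rewrite mxE abszM.
Qed.

Lemma height_gt0 (n : nat) (b : 'rV[int]_n.+1) : (0 < height b)%N = (b != 0).
Proof.
apply/idP/idP => [|/rV0Pn[j bj]].
  by apply: contraTneq => ->; rewrite -(scale0r 0) heightZ.
by apply: leq_trans (leq_bigmax j); rewrite absz_gt0.
Qed.

Section Dirichlet.
Context {p : nat} {hp : prime p}.
Local Notation Zp := (padicZ hp).

Lemma residue_absz_lt (z : Zp) k : (`|residue z k| < p ^ k)%N.
Proof.
have pk0 : (0 < p ^ k)%N by rewrite expn_gt0 prime_gt0.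
rewrite -ltz_nat -[residue z k]residue_mod gez0_abs; last first.
  by rewrite modz_ge0// eqz_nat -lt0n.
by rewrite ltz_pmod.
Qed.

Lemma residue_abszK (z : Zp) k : `|residue z k|%N = residue z k :> int.
Proof.
have pk0 : (0 < p ^ k)%N by rewrite expn_gt0 prime_gt0.
by rewrite gez0_abs// -[residue z k]residue_mod modz_ge0// eqz_nat -lt0n.
Qed.

(** The (N + 1)^(q + 1) vectors with entries in 0, ..., N outnumber the tuples of residues modulo
    p^(e_i); [b] is the difference of two vectors with equal residues. *)
Lemma padic_pigeonhole (I : finType) (q N : nat) (e : I -> nat)
    (lam : I -> 'rV[int]_q.+1 -> Zp) :
  (forall i a b, lam i (a - b) = lam i a - lam i b) ->
  (p ^ (\sum_i e i) < N.+1 ^ q.+1)%N ->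
  exists b : 'rV[int]_q.+1,
    [/\ b != 0, (height b <= N)%N & forall i, pdvd (e i) (lam i b)].
Proof.
move=> lamB card_lt.
pose vec (a : {ffun 'I_q.+1 -> 'I_N.+1}) : 'rV[int]_q.+1 :=
  \row_j (a j : nat)%:Z.
pose F (a : {ffun 'I_q.+1 -> 'I_N.+1}) : {dffun forall i, 'I_(p ^ e i)} :=
  [ffun i => Ordinal (residue_absz_lt (lam i (vec a)) (e i))].
have : ~~ injectiveb F.
  apply: contraTN card_lt => /injectiveP Finj; rewrite -leqNgt.
  have := leq_card F Finj; rewrite card_ffun !card_ord card_dep_ffun.
  rewrite foldrE big_image /=; under eq_bigr do rewrite card_ord.
  by rewrite expn_sum.
move=> /injectivePn[a [a' aa' Faa']]; exists (vec a - vec a'); split.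
- rewrite subr_eq0; apply: contraNneq aa' => /rowP vaa'.
  by apply/eqP/ffunP => j; have := vaa' j; rewrite !mxE => -[/val_inj].
- apply/bigmax_leqP => j _; rewrite !mxE.
  have dist (k l : nat) : (k < N.+1)%N -> (l < N.+1)%N ->
    (absz (k%:Z - l%:Z)%R <= N)%N by lia.
  exact: dist.
- move=> i; rewrite lamB; apply/pdvd_eqr.
  rewrite -[LHS]residue_abszK -[RHS]residue_abszK; congr Posz.
  by move/ffunP: Faa' => /(_ i); rewrite !ffunE => -[].
Qed.

Lemma p_primitive_part (q : nat) (b : 'rV[int]_q.+1) : b != 0 ->
  exists s b', b = (p ^ s)%N%:Z *: b' /\ exists j, ~~ (p %| b' ord0 j)%Z.
Proof.
have [n] := ubnP (height b); elim: n b => // n ih b bn b0.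
have [[j pj]|/forallNP allp] := pselect (exists j, ~~ (p %| b ord0 j)%Z).
  by exists 0%N, b; split; [rewrite scale1r|exists j].
pose b1 : 'rV[int]_q.+1 := \row_j (b ord0 j %/ p)%Z.
have bE : b = p%:Z *: b1.
  apply/rowP => j; rewrite !mxE mulrC divzK//.
  by apply: contraT => /allp.
have b10 : b1 != 0 by apply: contraNneq b0 => b10; rewrite bE b10 scaler0.
have [|s [b' [b1E nd]]] := ih b1 _ b10.
  move: bn; rewrite bE heightZ /= ltnS; apply: leq_trans.
  by rewrite ltn_Pmull ?prime_gt1// height_gt0.
by exists s.+1, b'; split=> //; rewrite bE b1E scalerA expnS PoszM.
Qed.

Definition approx_err (n : nat) (b : 'rV[int]_n.+1) (y : 'rV[Zp]_n) i : Zp :=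
  (b ord0 ord0)%:~R * y ord0 i - (b ord0 (lift ord0 i))%:~R.

Lemma approx_errZ n (c : int) (b : 'rV[int]_n.+1) y i :
  approx_err (c *: b) y i = c%:~R * approx_err b y i.
Proof. by rewrite /approx_err !mxE !rmorphM /=; ring. Qed.

Lemma approx_errB n (a b : 'rV[int]_n.+1) y i :
  approx_err (a - b) y i = approx_err a y i - approx_err b y i.
Proof. by rewrite /approx_err !mxE !rmorphD !rmorphN /=; ring. Qed.

(** The pigeonhole principle is applied to the first d errors, with exponents lowered by s = m (t +
    L), and to the m linearized forms, with exponents raised by t + L, where L is the valuation of
    v. Powers of p common to all entries are then divided out. *)
Lemma dirichlet_form (R : realType) (d m : nat) (tau : 'I_(d + m) -> R)
    (y : 'rV[Zp]_(d + m)) (v : Zp) (u : 'I_m -> 'I_d -> Zp)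
    (t H0 : nat) :
  (0 < d)%N -> (forall i, 1 < tau i) -> \sum_i tau i = (d + m)%:R + 1 ->
  v != 0 ->
  exists b : 'rV[int]_(d + m).+1,
    [/\ (H0 <= height b)%N, ~~ (p %| b ord0 ord0)%Z,
       forall i, pdvd (kappa (p := p) (tau (lshift m i)) (height b)
                       - m * (t + padic_val v)) (approx_err b y (lshift m i)) &
       forall j, pdvd (kappa (p := p) (tau (rshift d j)) (height b)
                       + (t + padic_val v))
         (v * approx_err b y (rshift d j) -
          \sum_i u j i * approx_err b y (lshift m i))].
Proof.
move=> d0 tau1 sum_tau v0.
have p1 := prime_gt1 hp; have p0 := prime_gt0 hp.
pose ka := @kappa R p; set L := padic_val v; set s := (m * (t + L))%N.
pose P (b : 'rV[int]_(d + m).+1) i : Zp := approx_err b y (lshift m i).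
pose S (b : 'rV[int]_(d + m).+1) j : Zp := approx_err b y (rshift d j).
pose Q b j : Zp := v * S b j - \sum_i u j i * P b i.
have QZ c b j : Q (c *: b) j = c%:~R * Q b j.
  rewrite /Q /S approx_errZ [RHS]mulrBr [in RHS]mulr_sumr mulrCA; congr (_ - _).
  by apply: eq_bigr => i _; rewrite /P approx_errZ mulrCA.
have QB a b j : Q (a - b) j = Q a j - Q b j.
  rewrite /Q /S approx_errB.
  have -> : \sum_i u j i * P (a - b) i =
      \sum_i u j i * P a i - \sum_i u j i * P b i.
    by rewrite -sumrB; apply: eq_bigr => i _; rewrite /P approx_errB mulrBr.
  by ring.
have tau0 i : 0 <= tau i by rewrite ltW// (lt_trans ltr01).
(* [k0] is prime to p and at least H0: it lengthens a vector without adding a factor p to b_0. *)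
pose k0 := (p * H0).+1.
(* [M] covers the loss s, the valuation L, one spare factor p and every exponent needed at height k0
   * H0. *)
pose M := (s + L + 1 + \max_i ka (tau i) (k0 * H0))%N.
have [N0 N0P] := kappa_large p1 M tau1.
pose N := maxn N0 1.
have N_gt0 : (0 < N)%N by rewrite leq_max orbT.
have kaN i : (trunc_log p N + M <= ka (tau i) N)%N.
  by apply: N0P => //; rewrite leq_maxl.
have Ms : (s + L + 1 <= M)%N by rewrite leq_addr.
pose lam (i : 'I_d + 'I_m) b := match i with inl i => P b i | inr j => Q b j end.
pose e (i : 'I_d + 'I_m) := match i with
  | inl i => (ka (tau (lshift m i)) N - s)%N
  | inr j => (ka (tau (rshift d j)) N + (t + L))%N end.
have [||b [b0 bN bdvd]] := padic_pigeonhole (N := N) (e := e) (lam := lam).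
- by move=> [i|j] a b; [exact: approx_errB|exact: QB].
(* The raised forms cost m (t + L) = s in total; the lowered ones save d * s >= s, since at [N] no
   subtraction of s is truncated. *)
- have le_e : (\sum_i e i <= \sum_i ka (tau i) N)%N.
    rewrite big_sumType /= [leqRHS]big_split_ord /=.
    rewrite big_split /= sum_nat_const card_ord -/s.
    have : (\sum_(i < d) (ka (tau (lshift m i)) N - s) + d * s =
            \sum_(i < d) ka (tau (lshift m i)) N)%N.
      rewrite -[X in (X * s)%N](card_ord d) -sum_nat_const -big_split /=.
      by apply: eq_bigr => i _; have := kaN (lshift m i); lia.
    by move=> <-; rewrite -addnA leq_add2l addnC leq_add2r leq_pmull.
  apply: (@leq_ltn_trans (N ^ (d + m).+1)); last by rewrite ltn_exp2r.
  apply: (@leq_trans (p ^ \sum_i ka (tau i) N)); first by rewrite leq_exp2l.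
  by apply: kappa_sum => //; rewrite sum_tau -natr1.
have [g [b' [bE [k pk]]]] := p_primitive_part b0.
have b'0 : b' != 0 by apply: contraNneq pk => ->; rewrite mxE.
have h'0 : (0 < height b')%N by rewrite height_gt0.
have h'N : (height b' * p ^ g <= N)%N by move: bN; rewrite bE heightZ mulnC.
have gN : (g <= trunc_log p N)%N.
  apply: trunc_log_max => //; apply: leq_trans h'N.
  by rewrite leq_pmull.
have Pb' i : pdvd (ka (tau (lshift m i)) N - s - g) (P b' i).
  have := bdvd (inl i); rewrite /= bE [P _ _]approx_errZ -[_%:~R]/((p ^ g)%N%:R) natrX.
  have := kaN (lshift m i) => kaNi.
  by rewrite -[X in pdvd X _](@subnK g) ?pdvdM_pexp//; lia.
have Qb' j : pdvd (ka (tau (rshift d j)) N + (t + L) - g) (Q b' j).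
  have := bdvd (inr j); rewrite /= bE QZ -[_%:~R]/((p ^ g)%N%:R) natrX.
  have := kaN (rshift d j) => kaNj.
  by rewrite -[X in pdvd X _](@subnK g) ?pdvdM_pexp//; lia.
(* If p divided b'_0, the divisibility of the forms would force p to divide every entry of b'. The
   extra exponent L is spent on cancelling v. *)
have pb'0 : ~~ (p %| b' ord0 ord0)%Z.
  apply: contra pk => pb'0.
  have dvdE a : (p %| a)%Z = pdvd 1 (a%:~R : Zp) by rewrite pdvd_int expn1.
  have PL i : pdvd (1 + L) (P b' i).
    by apply: pdvd_le (Pb' i); have := kaN (lshift m i); lia.
  case: (unliftP ord0 k) => [k' ->|->//].
  rewrite dvdE -pdvdN; case: (splitP k') => [i|j] k'E.
    have -> : k' = lshift m i by apply: val_inj.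
    have := pdvd_le (isT : (1 <= 1 + L)%N) (PL i); rewrite pdvdDr//.
    by rewrite mulrC pdvdMr// -dvdE.
  have -> : k' = rshift d j by apply: val_inj.
  have : pdvd (1 + L) (v * S b' j).
    rewrite -(pdvdDr _ (x := - \sum_i u j i * P b' i)).
      by rewrite addrC; apply: pdvd_le (Qb' j); have := kaN (rshift d j); lia.
    by rewrite pdvdN; apply: pdvd_sum => i _; apply: pdvdMr.
  by rewrite pdvdM_val// pdvdDr// mulrC pdvdMr// -dvdE.
(* If b' is too short, b' * k0 is long enough; N was chosen so large that the
   divisibility exponents still suffice for its height. *)
have [H0h'|h'H0] := leqP H0 (height b').
  have kah' i := kappaD p1 (ltW (tau1 i)) h'0 h'N.
  exists b'; split=> // [i|j].
    by apply: pdvd_le (Pb' i); have := kah' (lshift m i); rewrite /ka; lia.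
  by apply: pdvd_le (Qb' j); have := kah' (rshift d j); rewrite /ka; lia.
exists (k0%:Z *: b').
have hE : height (k0%:Z *: b') = (k0 * height b')%N by rewrite heightZ.
have kah i : (ka (tau i) (height (k0%:Z *: b')) + g + (s + L) <= ka (tau i) N)%N.
  have : (ka (tau i) (height (k0%:Z *: b')) <= ka (tau i) (k0 * H0))%N.
    by rewrite hE leq_kappa_height// leq_mul2l ltnW// orbT.
  have := leq_bigmax (F := fun i => ka (tau i) (k0 * H0)%N) i.
  by have := kaN i; rewrite /M; lia.
split=> [||i|j].
- rewrite hE; apply: leq_trans (leq_pmulr _ h'0).
  by rewrite /k0 ltnW// ltnS leq_pmull.
- rewrite mxE dvdzE abszM Euclid_dvdM// negb_or; apply/andP; split=> //=.
  by rewrite /k0 -addn1 dvdn_addr ?dvdn_mulr// dvdn1 neq_ltn p1 orbT.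
- rewrite approx_errZ; apply/pdvdMr; apply: pdvd_le (Pb' i).
  by have := kah (lshift m i); rewrite /ka; lia.
- rewrite -/(Q _ j) QZ; apply/pdvdMr; apply: pdvd_le (Qb' j).
  by have := kah (rshift d j); rewrite /ka; lia.
Qed.

End Dirichlet.

(** * Boxes on which a single b approximates the graph *)

Lemma dvdz_solve (p : nat) (a b : int) k : prime p -> ~~ (p %| a)%Z ->
  exists y : int, ((p ^ k)%N %| a * y - b)%Z.
Proof.
move=> p_pr pa; have [u [w uw]] := Bezoutz a (p ^ k)%N.
have g1 : gcdz a (p ^ k)%N = 1.
  apply/eqP; rewrite -[_ == _]/(coprimez _ _) coprimezE coprimeXr//.
  by rewrite coprime_sym prime_coprime.
exists (u * b); apply/dvdzP; exists (- (w * b)).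
have : (u * a + w * (p ^ k)%N%:Z) * b = b by rewrite uw g1 mul1r.
by move=> {2}<-; ring.
Qed.

Section Hole.
Context {p : nat} {hp : prime p}.
Local Notation Zp := (padicZ hp).

Lemma pdvdM_coprime (a : int) k (z : Zp) :
  ~~ (p %| a)%Z -> pdvd k (a%:~R * z) = pdvd k z.
Proof.
move=> pa; have a1 : ~~ pdvd 1 (a%:~R : Zp) by rewrite pdvd_int expn1.
have a0 : (a%:~R : Zp) != 0 by apply: contraNneq a1 => ->; apply: pdvd0.
have va : padic_val (a%:~R : Zp) = 0%N.
  by apply/eqP; rewrite -leqn0 leqNgt (padic_valP _ a0).
by rewrite -(pdvdM_val k z a0) va addn0.
Qed.

(** From h^t < p^(kappa + 1) and k < p^k it follows that k h^t < p^(kappa + k + 1). *)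
Lemma ratr_abs_lt (R : realType) (t : R) (h k : nat) (z : Zp) :
  0 <= t -> (0 < h)%N -> (0 < k)%N -> pdvd (kappa (p := p) t h + k.+1) z ->
  ratr (padicZ_abs z) < k%:R^-1 * h%:R `^ (- t) :> R.
Proof.
move=> t0 h0 k0; have p1 := prime_gt1 hp.
rewrite pdvdE -(ler_rat R) fmorphV rmorphXn /= ratr_nat => /le_lt_trans; apply.
have pR0 : 0 < (p%:R : R) by rewrite ltr0n prime_gt0.
have ht0 : 0 < (h%:R : R) `^ t by rewrite powR_gt0 ?ltr0n.
rewrite powRN -invfM ltf_pV2 ?posrE ?exprn_gt0 ?mulr_gt0 ?ltr0n ?(ltnW p1)//.
rewrite -addSnnS exprD mulrC ltr_pM ?ler0n ?powR_ge0 ?(kappa_lt p1)//.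
by rewrite -natrX ltr_nat ltn_expl.
Qed.

(** The hole is a box about the point with coordinates b_i / b_0, i <= d. Its exponents exceed those
    of the surrounding box of x by at most s + T, a number independent of x and h. *)
Lemma approx_hole (R : realType) (d m : nat) (tau : 'I_(d + m) -> R)
    (U : set 'rV[Zp]_d) (f : 'rV[Zp]_d -> 'rV[Zp]_m) (x0 : 'rV[Zp]_d)
    (r k : nat) :
  (0 < d)%N -> (forall i, 1 < tau i) -> \sum_i tau i = (d + m)%:R + 1 ->
  (forall i j, tau (rshift d j) <= tau (lshift m i)) ->
  open U -> is_Ck_map r.+1 U f -> U x0 -> (0 < k)%N ->
  let ka i h := kappa (p := p) (tau (lshift m i)) h in
  exists l s T, cell (fun=> l) x0 `<=` U /\
    forall H0 x, cell (fun=> l) x0 x -> exists h, (H0 <= h)%N /\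
      exists2 y, cell (fun i => ka i h - s)%N x y &
        forall z, cell (fun i => ka i h + T)%N y z ->
          exists2 b, height b = h & approx_by k%:R^-1 tau (row_mx z (f z)) b.
Proof.
move=> d0 tau1 sum_tau tau_le oU fC Ux0 k0 ka.
have p1 := prime_gt1 hp.
have tau0 i : 0 <= tau i by rewrite ltW// (lt_trans ltr01).
have [v [u [v0 sd]]] := Ck_strictly_differentiable (ltn0Sn r) oU fC Ux0.
(* [t] is the surplus that yields the constant 1/k, and [L] is the cost of cancelling v. The
   precision s + L + t requested next also absorbs the enlargement of the box of x by up to p^s. *)
pose L := padic_val v; pose t := k.+1; pose s := (m * (t + L))%N.
have [l [lU lP]] := sd (s + L + t)%N.
exists l, s, (t + L)%N; split=> // H0 x x0x.
(* Beyond this height the box of x has exponents at least l, so it stays where the linearization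
   holds. *)
have [N0 N0P] := kappa_large p1 (l + s) tau1.
have [b [Hb pb xb fb]] := dirichlet_form (row_mx x (f x)) u t
  (maxn H0 (maxn N0 1)) d0 tau1 sum_tau v0.
set h := height b in Hb xb fb; exists h.
have h0 : (0 < h)%N by apply: leq_trans Hb; rewrite !leq_max !orbT.
have kal i : (l + s <= ka i h)%N.
  apply: (leq_trans _ (N0P h _ h0 (lshift m i))); first by rewrite leq_addl.
  by apply: leq_trans Hb; rewrite !leq_max leqnn orbT.
split; first by apply: leq_trans Hb; rewrite leq_maxl.
set B0 := b ord0 ord0 in pb.
(* As p does not divide b_0, b_i / b_0 is a p-adic integer; [a] approximates it by an integer. *)
have /choice[a aP] : forall i : 'I_d, exists a : int,
    ((p ^ (ka i h + (t + L)))%N %| B0 * a - b ord0 (lift ord0 (lshift m i)))%Z.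
  by move=> i; apply: dvdz_solve.
pose y : 'rV[Zp]_d := \row_i (a i)%:~R.
have errl z i : approx_err b (row_mx z (f z)) (lshift m i) =
    B0%:~R * z ord0 i - (b ord0 (lift ord0 (lshift m i)))%:~R.
  by rewrite /approx_err row_mxEl.
have errr z j : approx_err b (row_mx z (f z)) (rshift d j) =
    B0%:~R * f z ord0 j - (b ord0 (lift ord0 (rshift d j)))%:~R.
  by rewrite /approx_err row_mxEr.
have zerr z : cell (fun i => ka i h + (t + L))%N y z ->
    forall i, pdvd (ka i h + (t + L)) (approx_err b (row_mx z (f z)) (lshift m i)).
  move=> yz i; rewrite errl -(subrK (y ord0 i) (z ord0 i)) mulrDr -addrA.
  by rewrite pdvdDr ?pdvdMr// mxE -rmorphM -rmorphB pdvd_int.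
have zx z : cell (fun i => ka i h + (t + L))%N y z ->
    cell (fun i => ka i h - s)%N x z.
  move=> yz i; rewrite -(pdvdM_coprime _ _ pb).
  rewrite (_ : _ * _ = approx_err b (row_mx z (f z)) (lshift m i) -
     approx_err b (row_mx x (f x)) (lshift m i)); last by rewrite !errl; ring.
  apply: pdvdB; last exact: xb.
  apply: pdvd_le (zerr _ yz i).
  by rewrite (leq_trans (leq_subr _ _))// leq_addr.
exists y; first exact/zx/cell_refl.
move=> z yz; exists b => // i; rewrite -/h.
rewrite -[_ - _]/(approx_err b (row_mx z (f z)) i).
apply: ratr_abs_lt => //; case: (splitP i) => [i'|j] iE.
  have -> : i = lshift m i' by apply: val_inj.
  by apply: pdvd_le (zerr _ yz i'); rewrite leq_add2l leq_addr.
have {i iE} -> : i = rshift d j by apply: val_inj.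
(* The comparison of weights enters here: the box of x lies in the cube of exponent kj - s, so the
   linearization error is small on the scale of tau_(d+j). *)
set kj := kappa _ _; have kji i : (kj <= ka i h)%N by apply: leq_kappa_weight.
have zl : cell (fun=> l) x0 z.
  apply: cell_trans x0x _; apply: cell_le (zx _ yz) => i.
  by have := kal i; lia.
have xz : cell (fun=> kj - s)%N x z.
  by apply: cell_le (zx _ yz) => i; have := kji i; lia.
rewrite -(pdvdM_val _ _ v0) -/L -addnA.
(* The three terms are the linearized form at x, b_0 times the linearization error between x and z,
   and u applied to the first d errors at z. Each is divisible by p^(kj + t + L). *)
have -> : v * approx_err b (row_mx z (f z)) (rshift d j) =
    (v * approx_err b (row_mx x (f x)) (rshift d j) -
     \sum_i u j i * approx_err b (row_mx x (f x)) (lshift m i)) +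
    B0%:~R * (v * (f z ord0 j - f x ord0 j) -
              \sum_i u j i * (z ord0 i - x ord0 i)) +
    \sum_i u j i * approx_err b (row_mx z (f z)) (lshift m i).
  have -> : \sum_i u j i * approx_err b (row_mx z (f z)) (lshift m i) =
      \sum_i u j i * approx_err b (row_mx x (f x)) (lshift m i) +
      B0%:~R * \sum_i u j i * (z ord0 i - x ord0 i).
    rewrite mulr_sumr -big_split /=; apply: eq_bigr => i _.
    by rewrite !errl; ring.
  by rewrite !errr; ring.
apply: pdvdD; first (apply: pdvdD).
- exact: fb.
- apply/pdvdMr/(pdvd_le _ (lP _ _ _ zl x0x xz j)).
  by rewrite -/t; lia.
- apply: pdvd_sum => i _; apply/pdvdMr/(pdvd_le _ (zerr _ yz i)).
  by rewrite leq_add2r.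
Qed.

End Hole.

(** * Measures of boxes and a density argument *)

Section Density.
Context {p : nat} {hp : prime p} {d : nat} {R : realType}.
Context (mu : probability (padic_borel hp d) R)
        (mu_inv : translation_invariant mu).
Local Notation Zp := (padicZ hp).
Local Notation X := (padic_borel hp d).
Implicit Types (x y z : 'rV[Zp]_d) (K : 'I_d -> nat) (A E F : set X).

Lemma open_borel_measurable (A : set 'rV[Zp]_d) :
  open A -> measurable (A : set X).
Proof. by move=> oA; apply: sub_sigma_algebra. Qed.

Lemma measurable_cell K x : measurable (cell K x : set X).
Proof. by apply: open_borel_measurable; apply: open_cell. Qed.

Lemma saturated_measurable K A :
  (forall x, A x -> cell K x `<=` A) -> measurable A.
Proof.
by move=> satA; apply: open_borel_measurable; apply: saturated_open satA.
Qed.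

Lemma mu_fineK A : measurable A -> (fine (mu A))%:E = mu A.
Proof. by move=> mA; rewrite fineK// fin_num_measure. Qed.

Lemma cell_eq K x y : cell K x y -> cell K y = cell K x.
Proof.
move=> xy; apply/seteqP; split=> z; first exact: cell_trans xy.
exact: cell_trans (cell_sym xy).
Qed.

Lemma mu_cell K x : mu (cell K x) = mu (cell K 0).
Proof.
rewrite -(mu_inv x (measurable_cell K 0)); congr (mu _); apply/seteqP; split.
  move=> y xy; exists (y - x); last by rewrite addrC subrK.
  by move=> i; rewrite !mxE subr0; apply: xy.
move=> _ [y y0 <-] i; have := y0 i; rewrite !mxE subr0.
by rewrite [x ord0 i + _]addrC addrK.
Qed.

(** [c] is made of the base p digits of [z] at positions k, ..., k + e - 1. *)
Lemma next_digits (z : Zp) k e : pdvd k z ->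
  exists c : 'I_(p ^ e), pdvd (k + e) (z - (c * p ^ k)%N%:R).
Proof.
move=> zk; have pk0 : (0 < p ^ k)%N by rewrite expn_gt0 prime_gt0.
set r := `|residue z (k + e)|%N.
have rE : r = residue z (k + e) :> int by rewrite residue_abszK.
have pr : (p ^ k %| r)%N.
  suff : ((p ^ k)%N %| r%:Z)%Z by [].
  rewrite rE; apply/dvdz_mod0P.
  by rewrite -residue_le ?leq_addr//; apply/eqP.
have rlt : (r %/ p ^ k < p ^ e)%N.
  by rewrite ltn_divLR// mulnC -expnD residue_absz_lt.
exists (Ordinal rlt) => /=; rewrite divnK//.
by apply/pdvd_eqr; rewrite -[r%:R]/((Posz r)%:~R) residue_int rE residue_mod.
Qed.

(** The next e digits of each coordinate select one of (p^e)^d boxes of shape K'. These cover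
    [cell K x] and have equal measure by translation invariance. *)
Lemma mu_cell_le K K' e x y : (forall i, (K' i <= K i + e)%N) ->
  (mu (cell K x) <= ((p ^ e) ^ d)%N%:R%:E * mu (cell K' y))%E.
Proof.
move=> KK'; pose I := {ffun 'I_d -> 'I_(p ^ e)}.
pose ctr (c : I) : 'rV[Zp]_d := x + \row_i (c i * p ^ K i)%N%:R.
pose A k : set X := cell K' (nth x [seq ctr c | c : I] k).
have mA k : measurable (A k) by apply: measurable_cell.
have cover : cell K x `<=` \bigcup_(k in `I_#|I|) A k.
  move=> z xz.
  have /choice[c cP] : forall i, exists c : 'I_(p ^ e),
      pdvd (K i + e) (z ord0 i - x ord0 i - (c * p ^ K i)%N%:R).
    by move=> i; apply: next_digits.
  exists (enum_rank [ffun i => c i]); first exact: ltn_ord.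
  rewrite /A nth_image enum_rankK => i; rewrite !mxE ffunE opprD addrA.
  exact: pdvd_le (cP i).
apply: (le_trans (content_sub_fsum mu (finite_II _) (fun k _ => mA k)
  (measurable_cell K x) cover)).
have muA k : mu (A k) = mu (cell K' y) by rewrite /A mu_cell -(mu_cell K' y).
rewrite -fsbig_ord mule_natl (eq_bigr (fun=> mu (cell K' y))) => [|k _].
  by rewrite sumr_const card_ord card_ffun !card_ord.
exact: muA.
Qed.

Lemma mu_hole K K' e E x y : (forall i, (K' i <= K i + e)%N) ->
  measurable E -> cell K' y `<=` cell K x -> E `&` cell K' y = set0 ->
  (mu (E `&` cell K x) <= (1 - (((p ^ e) ^ d)%N%:R)^-1)%:E * mu (cell K x))%E.
Proof.
move=> KK' mE yx Ey; have mx := measurable_cell K x.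
have my := measurable_cell K' y; have mEx := measurableI _ _ mE mx.
have := mu_cell_le x y KK'.
have : (mu (E `&` cell K x) + mu (cell K' y) <= mu (cell K x))%E.
  rewrite -measureU//; last by rewrite setIAC Ey set0I.
  apply: le_measure; rewrite ?inE//; first exact: measurableU.
  by move=> z [[]//|/yx].
rewrite -(mu_fineK mEx) -(mu_fineK mx) -(mu_fineK my) -EFinD -!EFinM !lee_fin.
set a := fine _; set b := fine _; set q := fine _ => abq qb.
set C : R := _%:R in qb *.
have C0 : 0 < C by rewrite ltr0n !expn_gt0 prime_gt0.
have : q / C <= b by rewrite ler_pdivrMr// mulrC.
by rewrite mulrBl mul1r [C^-1 * _]mulrC; lra.
Qed.

(** F is a finite disjoint union of boxes of shape K, so the bounds on single boxes add up. *)
Lemma mu_saturated_le K E F (c : R) : 0 <= c -> measurable E ->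
  (forall x, F x -> cell K x `<=` F) ->
  (forall x, F x -> (mu (E `&` cell K x) <= c%:E * mu (cell K x))%E) ->
  (mu (E `&` F) <= c%:E * mu F)%E.
Proof.
move=> c0 mE satF Fc; pose M := (\max_i K i)%N.
pose I := {ffun 'I_d -> 'I_(p ^ M)}.
(* The classes are indexed with the uniform bound p^M; those with some g_i >= p^(K i) are empty. *)
pose C (g : I) : set X := [set x | forall i, residue (x ord0 i) (K i) = g i].
have satC g x : C g x -> cell K x = C g.
  move=> gx; apply/seteqP; split=> y; first by move=> xy i; rewrite -gx pdvd_eqr.
  by move=> gy i; apply/pdvd_eqr; rewrite gx gy.
have mC g : measurable (C g).
  by apply: (@saturated_measurable K) => x gx; rewrite (satC _ _ gx).
have mF : measurable F by apply: saturated_measurable satF.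
have Ccover : \bigcup_(g in [set: I]) C g = setT.
  rewrite -subTset => x _.
  have ltM i : (`|residue (x ord0 i) (K i)| < p ^ M)%N.
    apply: leq_trans (residue_absz_lt _ _) _.
    by rewrite leq_exp2l ?prime_gt1// (leq_bigmax (F := K) i).
  exists [ffun i => Ordinal (ltM i)] => // i.
  by rewrite ffunE residue_abszK.
have Ctriv : trivIset [set: I] C.
  move=> g g' _ _ [x [gx g'x]]; apply/ffunP => i; apply/val_inj.
  by have := gx i; rewrite g'x => -[].
have split_mu (A : set X) : measurable A -> mu A = (\sum_(g \in [set: I]) mu (A `&` C g))%E.
  move=> mA; rewrite -measure_fin_bigcup//.
  - by rewrite -setI_bigcupr Ccover setIT.
  - exact: finite_finset.
  - by move=> g g' _ _ [x [[_ gx] [_ g'x]]]; apply: Ctriv => //; exists x.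
  - by move=> g _; apply: measurableI.
rewrite (split_mu (E `&` F)); last exact: measurableI.
rewrite (split_mu F)// ge0_mule_fsumr; last by move=> g; apply: measure_ge0.
apply: lee_fsum => [|g _]; first exact: finite_finset.
have [[x [Fx gx]]|noF] := pselect ((F `&` C g) !=set0).
  have FC : F `&` C g = cell K x.
    by rewrite -(satC _ _ gx); apply/setIidr/satF.
  by rewrite -setIA FC; apply: Fc.
have -> : E `&` F `&` C g = set0.
  by rewrite -setIA; apply/seteqP; split=> // x [_ Fgx]; apply: noF; exists x.
by rewrite measure0 mule_ge0// lee_fin.
Qed.

(** This replaces a density theorem. Boxes with holes, of levels >= h, cover E; sorting points by
    the first such level gives mu E <= c mu (V h), where V h is the union of the boxes of level h
    meeting E and c < 1. As E is closed, mu (V h) tends to mu E, so mu E <= c mu E. *)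
Lemma hole_density_null (K K' : nat -> 'I_d -> nat) (e : nat) E :
  (forall i h h', (h <= h')%N -> (K h i <= K h' i)%N) ->
  (forall k, exists h, forall i, (k <= K h i)%N) ->
  (forall h i, (K' h i <= K h i + e)%N) ->
  open (~` E : set 'rV[Zp]_d) ->
  (forall x, E x -> forall H0, exists2 h, (H0 <= h)%N &
    exists y, cell (K' h) y `<=` cell (K h) x /\ E `&` cell (K' h) y = set0) ->
  mu E = 0%E.
Proof.
move=> K_mono K_inf KK' oE E_hole.
have mE : measurable E.
  by rewrite -[E]setCK; apply: measurableC; apply: open_borel_measurable.
pose C : R := ((p ^ e) ^ d)%N%:R.
have C1 : 1 <= C by rewrite ler1n !expn_gt0 prime_gt0.
pose c : R := 1 - C^-1.
have c0 : 0 <= c by rewrite subr_ge0 invf_le1// (lt_le_trans ltr01).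
have c1 : c < 1 by rewrite ltrBlDr ltrDl invr_gt0 (lt_le_trans ltr01).
(* S h is the union of the boxes of level h of which E occupies a proportion at
   most c; those of levels H0, ..., H0 + n - 1 cover E in the limit. *)
pose S h : set X := [set x | exists2 w, E w & cell (K h) w x /\
  (mu (E `&` cell (K h) w) <= c%:E * mu (cell (K h) w))%E].
have S_hole x H0 : E x -> exists2 h, (H0 <= h)%N & S h x.
  move=> Ex; have [h H0h [y [yx Ey]]] := E_hole x Ex H0; exists h => //.
  exists x => //; split; first exact: cell_refl.
  exact: mu_hole (KK' h) mE yx Ey.
pose G H0 n : set X := [set x | exists2 h, (H0 <= h < H0 + n)%N & S h x].
have satS h x : S h x -> cell (K h) x `<=` S h.
  by move=> [w Ew [wx muw]] y xy; exists w => //; split=> //; apply: cell_trans xy.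
have satG H0 n x : G H0 n x -> cell (K (H0 + n)%N) x `<=` G H0 n.
  move=> [h hn Sx] y xy; exists h => //; apply: satS Sx _ _.
  by apply: cell_le xy => i; apply: K_mono; case/andP: hn => _ /ltnW.
have mG H0 n : measurable (G H0 n) by apply: saturated_measurable (@satG H0 n).
have muG H0 n : (mu (E `&` G H0 n) <= c%:E * mu (G H0 n))%E.
  elim: n => [|n ih].
    have -> : G H0 0%N = set0.
      by apply/seteqP; split=> // x [h]; rewrite addn0; case: ltngtP.
    by rewrite setI0 measure0 mule0.
  (* [D] holds the points first reached at level H0 + n. Boxes of earlier levels are unions of boxes
     of this level, so [D] is such a union too. *)
  pose D : set X := S (H0 + n)%N `\` G H0 n.
  have satD x : D x -> cell (K (H0 + n)%N) x `<=` D.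
    move=> [Sx nGx] y xy; split; first exact: satS xy.
    by move=> Gy; apply/nGx/(satG _ _ _ Gy)/cell_sym.
  have mD : measurable D by apply: saturated_measurable satD.
  have GD : G H0 n.+1 = G H0 n `|` D.
    apply/seteqP; split=> x.
      move=> [h]; rewrite addnS ltnS [(h <= _)%N]leq_eqVlt.
      move=> /andP[H0h /orP[/eqP hE|hlt]] Sx; last first.
        by left; exists h => //; rewrite H0h.
      have [Gx|nGx] := pselect (G H0 n x); first by left.
      by right; split=> //; rewrite -hE.
    move=> [[h /andP[H0h hlt] Sx]|[Sx _]]; [exists h => //|exists (H0 + n)%N => //].
      by rewrite H0h addnS ltnW.
    by rewrite leq_addr addnS ltnSn.
  have GID : G H0 n `&` D = set0 by apply/seteqP; split=> // x [Gx []].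
  rewrite GD setIUr (measureU mu (mG H0 n) mD GID).
  rewrite (measureU mu (measurableI _ _ mE (mG H0 n)) (measurableI _ _ mE mD));
    last by rewrite setIACA GID setI0.
  rewrite ge0_muleDr ?measure_ge0//; apply: leeD => //.
  apply: (mu_saturated_le c0 mE satD) => x [[w Ew [wx muw]] _].
  by rewrite (cell_eq wx).
pose V h : set X := [set x | exists2 w, E w & cell (K h) w x].
have mV h : measurable (V h).
  apply: (@saturated_measurable (K h)) => x [w Ew wx] y xy.
  by exists w => //; apply: cell_trans xy.
have EV h : (mu E <= c%:E * mu (V h))%E.
  have EG : \bigcup_n (E `&` G h n) = E.
    apply/seteqP; split=> [x [n _ []]//|x Ex].
    have [h' hh' Sx] := S_hole x h Ex; exists (h' - h).+1 => //.
    by split=> //; exists h' => //; rewrite hh' addnS subnKC ?ltnSn.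
  have := @nondecreasing_cvg_mu _ _ _ mu (fun n => E `&` G h n).
  rewrite EG => /(_ (fun n => measurableI _ _ mE (mG h n)) mE) cvg_mu.
  apply: cvge_to_le (cvg_mu _) _.
    move=> n n' nn'; apply/subsetPset => x [Ex [h' /andP[hh' hn] Sx]].
    by split=> //; exists h' => //; rewrite hh' (leq_trans hn)// leq_add2l.
  apply: nearW => n; apply: (le_trans (muG h n)).
  rewrite lee_wpmul2l ?lee_fin//; apply: le_measure; rewrite ?inE//.
  move=> x [h' /andP[hh' _] [w Ew [wx _]]]; exists w => //.
  by apply: cell_le wx => i; apply: K_mono.
have VE : \bigcap_h V h = E.
  apply/seteqP; split=> [x Vx|x Ex h _]; last by exists x => //; apply: cell_refl.
  apply: contrapT => nEx; have [k kE] := (open_cellP _).1 oE x nEx.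
  have [h hk] := K_inf k; have [w Ew wx] := Vx h I.
  by apply: (kE w) => //; apply: cell_le (cell_sym wx).
have cvgV : mu (V h) @[h --> \oo] --> mu E.
  rewrite -[in X in _ --> X]VE; apply: nonincreasing_cvg_mu => //.
  - by rewrite ltey_eq fin_num_measure.
  - by rewrite VE.
  - move=> h h' hh'; apply/subsetPset => x [w Ew wx]; exists w => //.
    by apply: cell_le wx => i; apply: K_mono.
have : (mu E <= c%:E * mu E)%E.
  have cvg_c := @cvgeZl _ _ _ (mu \o V) (mu E) c%:E isT cvgV.
  by apply: (cvge_ge _ cvg_c); apply: nearW => h; apply: EV.
rewrite -(mu_fineK mE) -EFinM lee_fin => le_c; congr (_%:E).
have : 0 <= fine (mu E) by rewrite fine_ge0.
by move: le_c; set a := fine _ => ? ?; nra.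
Qed.

End Density.

(** * Measurability and nullity of the bad set *)

Lemma finite_height_lt n H : finite_set [set b : 'rV[int]_n.+1 | (height b < H)%N].
Proof.
pose g (c : {ffun 'I_n.+1 -> 'I_(H + H)}) : 'rV[int]_n.+1 :=
  \row_j ((c j : nat)%:Z - H%:Z).
apply: (@sub_finite_set _ _ (g @` setT)); last exact/finite_image/finite_finset.
move=> b /= bH.
have bjH j : (`|b ord0 j| < H)%N.
  by apply: leq_ltn_trans bH; apply: (leq_bigmax (F := fun j => `|b ord0 j|%N) j).
have lt2 j : (absz (b ord0 j + H%:Z)%R < H + H)%N by have := bjH j; lia.
exists [ffun j => Ordinal (lt2 j)] => //.
apply/rowP => j; rewrite mxE ffunE /=.
have shiftK (a : int) : (absz a < H)%N -> a = (absz (a + H%:Z))%:Z - H%:Z by lia.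
exact: esym (shiftK _ (bjH j)).
Qed.

(** Only finitely many integer vectors have height below a given bound. *)
Lemma infinite_heightP n (A : set 'rV[int]_n.+1) :
  infinite_set A <-> forall H, exists2 b, A b & (H <= height b)%N.
Proof.
split=> [infA H|hA finA].
  apply: contrapT => noH; apply: infA; apply: sub_finite_set (finite_height_lt n H).
  by move=> b Ab /=; rewrite ltnNge; apply/negP => Hb; apply: noH; exists b.
have [s sA] := (finite_seqP A).1 finA.
have [b Ab] := hA (\max_(b <- s) height b).+1.
rewrite ltnNge => /negP; apply; apply: leq_bigmax_seq => //.
by move: Ab; rewrite sA.
Qed.

Section NullSet.
Context {p : nat} {hp : prime p} {d m : nat} {R : realType}.
Context (mu : probability (padic_borel hp d) R)
        (mu_inv : translation_invariant mu).
Context (U : set 'rV[padicZ hp]_d) (f : 'rV[padicZ hp]_d -> 'rV[padicZ hp]_m)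
        (r : nat) (oU : open U) (fC : is_Ck_map r.+1 U f)
        (tau : 'I_(d + m) -> R).
Local Notation Zp := (padicZ hp).
Local Notation X := (padic_borel hp d).
Local Notation Y x := (row_mx x (f x)).
Implicit Types (x y z : 'rV[Zp]_d).

(** By strict differentiability the increments of v f are at least as divisible as those of x;
    cancelling v costs its valuation. *)
Lemma Ck_residue_continuous x0 k : U x0 ->
  exists l, cell (fun=> l) x0 `<=` U /\
    forall x, cell (fun=> l) x0 x -> cell (fun=> k) (f x0) (f x).
Proof.
move=> Ux0; have [v [u [v0 sd]]] := Ck_strictly_differentiable (ltn0Sn r) oU fC Ux0.
have [l [lU lP]] := sd 0%N.
pose L := maxn l (k + padic_val v); exists L.
have Ll : cell (fun=> L) x0 `<=` cell (fun=> l) x0.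
  by apply: cell_le => i; apply: leq_maxl.
split=> [x /Ll/lU//|x x0x j].
have x0kx : cell (fun=> k + padic_val v)%N x0 x.
  by apply: cell_le x0x => i; apply: leq_maxr.
rewrite -(pdvdM_val _ _ v0).
have := lP x x0 _ (Ll _ x0x) (cell_refl _ _) x0kx j; rewrite addn0 addrC pdvdDr//.
by rewrite pdvdN; apply: pdvd_sum => i _; apply: pdvdMr.
Qed.

Lemma ratr_abs_lt_near (w : Zp) (c : R) : ratr (padicZ_abs w) < c ->
  exists k, forall z : Zp, pdvd k (z - w) -> ratr (padicZ_abs z) < c.
Proof.
move=> wc; have c0 : 0 < c.
  by apply: le_lt_trans wc; rewrite ler0q padicZ_abs_ge0.
have [k kc] := pexpV_lt (prime_gt1 hp) c0; exists k => z.
rewrite pdvdE -(ler_rat R) fmorphV rmorphXn /= ratr_nat => /le_lt_trans/(_ kc) zw.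
have := padicZ_absD (z - w) w; rewrite subrK le_max -!(ler_rat R).
by move=> /orP[] /le_lt_trans; apply.
Qed.

Lemma open_approx_by (c : R) b : open [set x | U x /\ approx_by c tau (Y x) b].
Proof.
apply/open_cellP => x0 [Ux0 x0b].
have /choice[k kP] : forall i, exists k, forall z : Zp,
    pdvd k (z - approx_err b (Y x0) i) ->
    ratr (padicZ_abs z) < c * (height b)%:R `^ (- tau i).
  by move=> i; apply/ratr_abs_lt_near/x0b.
pose M := (\max_i k i)%N.
have [l [lU lP]] := Ck_residue_continuous M Ux0.
exists (maxn l M) => x x0x.
have xl : cell (fun=> l) x0 x by apply: cell_le x0x => i; apply: leq_maxl.
have xM : cell (fun=> M) x0 x by apply: cell_le x0x => i; apply: leq_maxr.
split; first exact: lU.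
move=> i; apply: kP; apply: (@pdvd_le _ _ _ M); first exact: (leq_bigmax (F := k) i).
rewrite (_ : _ - _ = (b ord0 ord0)%:~R * (Y x ord0 i - Y x0 ord0 i)); last first.
  by rewrite /approx_err; ring.
apply: pdvdMr; case: (splitP i) => [i'|j] iE.
  have -> : i = lshift m i' by apply: val_inj.
  by rewrite !row_mxEl; apply: xM.
have -> : i = rshift d j by apply: val_inj.
by rewrite !row_mxEr; apply: lP.
Qed.

(** A limsup set: a countable intersection over H of unions of open sets. *)
Lemma measurable_W (c : R) : measurable ([set x | U x /\ W c tau (Y x)] : set X).
Proof.
pose O b : set 'rV[Zp]_d := [set x | U x /\ approx_by c tau (Y x) b].
have -> : [set x | U x /\ W c tau (Y x)] =
    \bigcap_H \bigcup_(b in [set b | (H <= height b)%N]) O b.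
  apply/seteqP; split=> [x [Ux /infinite_heightP Wx] H _|x Ox].
    by have [b xb Hb] := Wx H; exists b.
  have [b0 _ [Ux _]] := Ox 0%N I; split=> //; apply/infinite_heightP => H.
  by have [b Hb [_ xb]] := Ox H I; exists b.
apply: bigcapT_measurable => H; apply: open_borel_measurable.
by apply: bigcup_open => b _; apply: open_approx_by.
Qed.

Lemma negligible_bigcup_countable (I : countType) (F : I -> set X) :
  (forall i, mu.-negligible (F i)) -> mu.-negligible (\bigcup_i F i).
Proof.
move=> negF.
have -> : \bigcup_i F i = \bigcup_n (if unpickle n is Some i then F i else set0).
  apply/seteqP; split=> [x [i _ Fx]|x [n _]].
    by exists (pickle i); rewrite ?pickleK.
  by case: (unpickle n) => // i Fx; exists i.
apply: negligible_bigcup => n; case: (unpickle n) => //.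
exact: negligible_set0.
Qed.

Context (d_gt0 : (0 < d)%N) (tau1 : forall i, 1 < tau i)
  (sum_tau : \sum_i tau i = (d + m)%:R + 1)
  (tau_le : forall i j, tau (rshift d j) <= tau (lshift m i)).

(** The union of these sets over H is the complement of W(1/k) pulled back to U. *)
Definition avoided (k H : nat) : set X :=
  [set x | U x /\ forall b, (H <= height b)%N -> ~ approx_by k%:R^-1 tau (Y x) b].

(** Inside a box contained in U the set is closed, and the holes of height at least H miss it, so
    the density argument applies. *)
Lemma avoided_locally_null k H x0 : (0 < k)%N -> U x0 ->
  exists l, mu (avoided k H `&` cell (fun=> l) x0) = 0%E.
Proof.
move=> k0 Ux0; have p1 := prime_gt1 hp.
have [l [s [T [lU holeP]]]] := approx_hole d_gt0 tau1 sum_tau tau_le oU fC Ux0 k0.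
exists l; pose ka i h := kappa (p := p) (tau (lshift m i)) h.
apply: (@hole_density_null _ _ _ _ _ mu_inv (fun h i => ka i h - s)%N
  (fun h i => ka i h + T)%N (s + T)%N) => [i h h' hh'|k1|h i||x [[Ux xb] x0x] H0].
- by rewrite leq_sub2r// leq_kappa_height// ltW// (lt_trans ltr01).
- have [N0 N0P] := kappa_large p1 (k1 + s) tau1; exists (maxn N0 1) => i.
  have := N0P _ (leq_maxl N0 1) (leq_maxr N0 1) (lshift m i).
  by rewrite -/(ka i _); lia.
- by lia.
- have -> : ~` (avoided k H `&` cell (fun=> l) x0) =
      ~` cell (fun=> l) x0 `|` \bigcup_(b in [set b | (H <= height b)%N])
        [set x | U x /\ approx_by k%:R^-1 tau (Y x) b].
    apply/seteqP; split=> [x nx|x [nx [_ //]|[b Hb [Ux xb]] [[_ /(_ b Hb)]//]]].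
    have [xl|] := pselect (cell (fun=> l) x0 x); last by left.
    right; apply: contrapT => nb; apply: nx; split=> //; split; first exact: lU.
    by move=> b Hb xb; apply: nb; exists b => //; split=> //; apply: lU.
  apply: openU; last by apply: bigcup_open => b _; apply: open_approx_by.
  apply: (@saturated_open _ _ _ (fun=> l)) => x nx y xy x0y; apply: nx.
  exact: cell_trans x0y (cell_sym xy).
- have [h [Hh [y xy yP]]] := holeP (maxn H0 H) x x0x.
  exists h; first by apply: leq_trans Hh; apply: leq_maxl.
  exists y; split.
    move=> z yz; apply: cell_trans xy _; apply: cell_le yz => i.
    by rewrite (leq_trans (leq_subr _ _))// leq_addr.
  apply/seteqP; split=> // z [[[_ zb] _] /yP[b hb]]; apply: zb.
  by rewrite hb; apply: leq_trans Hh; apply: leq_maxr.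
Qed.

Lemma measurable_avoided k H : measurable (avoided k H).
Proof.
have -> : avoided k H = (U : set X) `\` \bigcup_(b in [set b | (H <= height b)%N])
    [set x | U x /\ approx_by k%:R^-1 tau (Y x) b].
  apply/seteqP; split=> [x [Ux xb]|x [Ux xb]]; split=> //.
    by move=> [b Hb [_ /xb]]; apply.
  by move=> b Hb xab; apply: xb; exists b.
apply: measurableD; apply: open_borel_measurable => //.
by apply: bigcup_open => b _; apply: open_approx_by.
Qed.

(** The boxes with integer centres and equal sides are countably many; those on which the set is
    null already cover it. *)
Lemma avoided_negligible k H : (0 < k)%N -> mu.-negligible (avoided k H).
Proof.
move=> k0.
pose F (lc : nat * 'rV[int]_d) : set X :=
  avoided k H `&` cell (fun=> lc.1) (map_mx intr lc.2).
pose G lc := if `[< mu.-negligible (F lc) >] then F lc else set0.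
apply: (@negligibleS _ _ _ mu (\bigcup_lc G lc)); last first.
  apply: negligible_bigcup_countable => lc; rewrite /G.
  by case: asboolP => // _; apply: negligible_set0.
move=> x Ax; have [l l0] := avoided_locally_null H k0 Ax.1.
pose c : 'rV[int]_d := \row_i residue (x ord0 i) l.
have xc : cell (fun=> l) (map_mx intr c : 'rV[Zp]_d) x.
  by move=> i; apply/pdvd_eqr; rewrite !mxE residue_int residue_mod.
have Fneg : mu.-negligible (F (l, c)).
  apply/negligibleP; first exact: measurableI (measurable_avoided _ _) (measurable_cell _ _).
  by rewrite /F /= -(cell_eq xc).
exists (l, c) => //; rewrite /G; case: asboolP => // _; split=> //.
Qed.

Lemma bad_null : mu [set x | U x /\ Bad tau (Y x)] = 0%E.
Proof.
pose A c : set X := [set x | U x /\ W c tau (Y x)].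
have badE : [set x | U x /\ Bad tau (Y x)] =
    A 1 `\` \bigcap_(k in [set k : nat | (0 < k)%N]) A k%:R^-1.
  apply/seteqP; split=> [x [Ux [W1 nW]]|x [[Ux W1] nW]]; split=> //.
    by move=> AW; apply: nW => k k0; have [] := AW k k0.
  by split=> // BW; apply: nW => k k0; split=> //; apply: BW.
apply/negligibleP.
  rewrite badE; apply: measurableD; first exact: measurable_W.
  by apply: bigcap_measurable => [|k _]; [exists 1%N|apply: measurable_W].
(* The shift of the first index makes the constants 1/(k + 1) run over all positive denominators. *)
apply: (@negligibleS _ _ _ mu (\bigcup_kH avoided kH.1.+1 kH.2)); last first.
  by apply: negligible_bigcup_countable => -[k H]; apply: avoided_negligible.
move=> x [Ux [_]]; apply: contra_notP => nA k k0.
apply/infinite_heightP => H; apply: contrapT => nb; apply: nA.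
exists (k.-1, H) => //=; rewrite prednK//; split=> // b Hb xb.
by apply: nb; exists b.
Qed.

End NullSet.

(** * Badly approximable points on the graph of a C^2 map *)

Theorem theorem8p4 (R : realType) (p : nat) (hp : prime p) (d m : nat)
    (hd : (1 <= d)%N) (hm : (1 <= m)%N)
    (mu : probability (padic_borel hp d) R) (hmu : translation_invariant mu)
    (U : set 'rV[padicZ hp]_d) (hU : open U)
    (f : 'rV[padicZ hp]_d -> 'rV[padicZ hp]_m) (hf : is_Ck_map 2 U f)
    (tau : 'I_(d + m) -> R) (htau : forall i, 1 < tau i)
    (hsum : \sum_(i < d + m) tau i = (d + m)%:R + 1)
    (hmin : (\big[Order.min/+oo]_(i < d) (tau (lshift m i))%:E >=
             \big[Order.max/-oo]_(j < m) (tau (rshift d j))%:E)%E) :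
  mu [set x | U x /\ Bad tau (row_mx x (f x))] = 0%E.
Proof.
apply: (bad_null hmu hU hf hd htau hsum) => i j.
rewrite -lee_fin.
apply: (le_trans (le_bigmax -oo%E (fun j => (tau (rshift d j))%:E) j)).
apply: (le_trans hmin).
exact: (bigmin_le +oo%E i (fun i => (tau (lshift m i))%:E)).
Qed.
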